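(* For $x\ge0$ let $q(x)=x^2/2+\tfrac12\log(2\pi)-\log Y(x)$ (so $q$ is an increasing bijection $[0,\infty)\to[\log2,\infty)$), and extend $q^{-1}$ by $q^{-1}(y)=-\infty$ for $y\le0$ if needed. Let $n\ge1$, $0<\hat\theta<1$ with $n\hat\theta$ an integer, and $\log 2<\alpha\le n\hat\theta^2(1-\hat\theta)^2/8$. Write $r=\sqrt{n\hat\theta(1-\hat\theta)}$. Then there is a solution $\gamma_\alpha$ of $-\log P_{\mathrm{X},n}\big(\hat\theta\,\big|\,\varphi(\gamma_\alpha,\hat\theta)\big)=\alpha$ satisfying $$\gamma_\alpha\in\max\!\left(0,\,q^{-1}\!\left(\alpha\Big(1+\tfrac{64\sqrt\alpha/(15\sqrt{15})}{r}[-1,1]\Big)+\tfrac{\sqrt{\pi/6}+8\sqrt\alpha/\sqrt{15}}{r}[-1,1]\right)\right)\times\left(1+\tfrac{2\sqrt\alpha/\sqrt5}{r}[-1,1]\right),$$ where interval expressions are evaluated monotonically: the lower (resp. upper) bound on $\gamma_\alpha$ is obtained by taking all lower (resp. upper) endpoints of the intervals $[-1,1]$.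
   Context: Logarithms are natural. $Y(x)=e^{x^2/2}\int_x^\infty e^{-s^2/2}\,ds$. $P_{\mathrm{X},n}(t|\varphi)=\sum_{k\ge nt}\binom{n}{k}\varphi^k(1-\varphi)^{n-k}$. With $\hat\sigma=\sqrt{\hat\theta(1-\hat\theta)/n}$, $\varphi(\gamma,\hat\theta)=\hat\theta-\hat\sigma\gamma$. *)

(* Defs.v *)
From Stdlib Require Import Reals Lra ClassicalEpsilon.
Open Scope R_scope.

Definition gauss (s : R) : R := exp (- (s ^ 2) / 2).

Definition is_gauss_tail (x I : R) : Prop :=
  forall eps : R, 0 < eps ->
    exists B : R, forall b : R, B <= b ->
      forall pr : Riemann_integrable gauss x b,
        Rabs (RiemannInt pr - I) < eps.

Definition gauss_tail (x : R) : R :=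
  epsilon (inhabits 0) (fun I => is_gauss_tail x I).

Definition Ymills (x : R) : R := exp (x ^ 2 / 2) * gauss_tail x.

Definition qfun (x : R) : R := x ^ 2 / 2 + / 2 * ln (2 * PI) - ln (Ymills x).

(* max(0, q^{-1}(y)): q is an increasing bijection [0,oo) -> [log 2, oo),
   so for y > log 2 this is the x >= 0 with q x = y, and otherwise 0. *)
Definition max0_qinv (y : R) : R :=
  if Rle_dec y (ln 2) then 0
  else epsilon (inhabits 0) (fun x => 0 <= x /\ qfun x = y).

Definition PX (n : nat) (t phi : R) : R :=
  sum_f_R0 (fun k => if Rle_dec (INR n * t) (INR k)
                     then C n k * phi ^ k * (1 - phi) ^ (n - k) else 0) n.

Definition varphi (n : nat) (gamma theta : R) : R :=
  theta - sqrt (theta * (1 - theta) / INR n) * gamma.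

(* Main.v *)
Require Import Defs.
From Stdlib Require Import Arith Reals Lra Lia ClassicalEpsilon.
From Coquelicot Require Import Coquelicot.
Open Scope R_scope.

(** Write m = n theta, H for the relative entropy of theta with respect to phi,
    x = sqrt (2 n H), u = x / r, and Q for the standard normal upper tail, so
    that q = - log Q.  With kappa = sqrt (2 pi) r P(Bin(n, theta) = m), the
    binomial tail P satisfies |dP/dphi| = kappa g |dQ(x)/dphi|, where elementary
    bounds on H give 1 <= g <= 1 + u for phi < theta and 1 - u <= g <= 1 for
    phi > theta.  Integrating from 0 and from 1, with G the normal density,
      kappa Q(x) <= P <= kappa (Q(x) + G(x) / r)        for phi <= theta,
      kappa (Q(x) - G(x) / r) <= 1 - P <= kappa Q(x)    for phi >= theta.
    At phi = theta these yield P >= 1/2 and kappa = 1 + O(1/r), with no recourse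
    to Stirling's formula.  Hence P and Q(x) agree up to a controlled factor,
    and it remains to compare x with gamma through
    u - u^2/2 <= gamma / r <= u + u^2/2. *)

(** * The Gaussian integral *)

(** Differentiability is asked only in the open interval because [dev th] has a corner at [th], a
    possible endpoint in the later applications. *)
Lemma MVT_incr (f df : R -> R) (a b : R) :
  a <= b ->
  (forall x, a < x < b -> is_derive f x (df x)) ->
  (forall x, a <= x <= b -> continuity_pt f x) ->
  (forall x, a < x < b -> 0 <= df x) ->
  f a <= f b.
Proof.
  intros hab hd hc hp.
  (* The mean value point may be an endpoint, where the sign of [df] is unknown; [Rabs] makes the
     sign automatic and agrees with [df] inside. *)
  destruct (MVT_gen f a b (fun x => Rabs (df x))) as [c [_ hc']].
  - intros x; rewrite Rmin_left, Rmax_right by lra; intros hx.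
    rewrite Rabs_pos_eq by (apply hp; lra). apply hd; lra.
  - intros x; rewrite Rmin_left, Rmax_right by lra; intros hx. apply hc; lra.
  - assert (0 <= Rabs (df c) * (b - a)) by (apply Rmult_le_pos; [apply Rabs_pos | lra]).
    lra.
Qed.

Lemma is_derive_incr (f df : R -> R) (a b : R) :
  a <= b ->
  (forall x, a <= x <= b -> is_derive f x (df x)) ->
  (forall x, a <= x <= b -> 0 <= df x) ->
  f a <= f b.
Proof.
  intros hab hd hp. apply MVT_incr with df; auto.
  - intros x hx; apply hd; lra.
  - intros x hx. apply derivable_continuous_pt. exists (df x).
    apply is_derive_Reals; apply hd; lra.
  - intros x hx; apply hp; lra.
Qed.

Lemma continuous_gauss (x : R) : continuous gauss x.
Proof.
  apply (ex_derive_continuous gauss). unfold gauss. auto_derive. trivial.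
Qed.

Lemma ex_RInt_gauss (a b : R) : ex_RInt gauss a b.
Proof. apply (ex_RInt_continuous gauss). intros; apply continuous_gauss. Qed.

Definition gauss_prim (x : R) : R := RInt gauss 0 x.

Lemma is_derive_gauss_prim (x : R) : is_derive gauss_prim x (gauss x).
Proof.
  apply (is_derive_RInt gauss gauss_prim 0).
  - apply filter_forall; intros y.
    exact (RInt_correct gauss 0 y (ex_RInt_gauss 0 y)).
  - apply continuous_gauss.
Qed.

Lemma gauss_prim_0 : gauss_prim 0 = 0.
Proof. exact (RInt_point 0 gauss). Qed.

Lemma gauss_prim_pos (x : R) : 0 <= x -> 0 <= gauss_prim x.
Proof.
  intros hx. apply RInt_ge_0; [exact hx | apply ex_RInt_gauss|].
  intros y _. apply Rlt_le, exp_pos.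
Qed.

(* The other summand in the classical identity
   (int_0^x e^(-s^2/2) ds)^2 + int_0^1 gauss_polar x = pi / 2. *)
Definition gauss_polar (x t : R) : R := 2 * exp (- (x ^ 2) * (1 + t ^ 2) / 2) / (1 + t ^ 2).

Lemma ex_RInt_gauss_polar (x : R) : ex_RInt (gauss_polar x) 0 1.
Proof.
  apply (ex_RInt_continuous (gauss_polar x)). intros t _.
  apply (ex_derive_continuous (gauss_polar x)). unfold gauss_polar. auto_derive. nra.
Qed.

Lemma is_derive_gauss_polar (x t : R) :
  is_derive (fun y => gauss_polar y t) x (- 2 * x * exp (- (x ^ 2) * (1 + t ^ 2) / 2)).
Proof.
  unfold gauss_polar. evar_last.
  { auto_derive; [trivial|reflexivity]. }
  simpl.
  replace (- (x * (x * 1)) * (1 + t * (t * 1)) * / 2) with (- (x ^ 2) * (1 + t ^ 2) / 2) by (simpl; field).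
  replace (- (x * (x * 1)) * (1 + t * (t * 1)) / 2) with (- (x ^ 2) * (1 + t ^ 2) / 2) by (simpl; field).
  field. nra.
Qed.

Lemma is_derive_RInt_gauss_polar (x : R) :
  is_derive (fun y => RInt (gauss_polar y) 0 1) x
    (RInt (fun t => - 2 * x * exp (- (x ^ 2) * (1 + t ^ 2) / 2)) 0 1).
Proof.
  rewrite <- (RInt_ext (fun t => Derive (fun y => gauss_polar y t) x)).
  2: { intros t _. apply is_derive_unique, is_derive_gauss_polar. }
  apply is_derive_RInt_param.
  - apply filter_forall; intros y t _. eexists; apply is_derive_gauss_polar.
  - intros t _.
    apply continuity_2d_pt_ext with
      (fun u v => (- 2 * u) * exp (- (u * u) * (1 + v * v) * / 2)).
    { intros u v. symmetry. apply is_derive_unique.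
      evar_last; [apply is_derive_gauss_polar|]. f_equal. f_equal. field. }
    repeat first [ apply continuity_2d_pt_mult | apply continuity_2d_pt_plus
      | apply continuity_2d_pt_opp | apply continuity_2d_pt_const
      | apply continuity_2d_pt_id1 | apply continuity_2d_pt_id2 ].
    apply (continuity_1d_2d_pt_comp exp).
    + apply derivable_continuous_pt, derivable_pt_exp.
    + repeat first [ apply continuity_2d_pt_mult | apply continuity_2d_pt_plus
      | apply continuity_2d_pt_opp | apply continuity_2d_pt_const
      | apply continuity_2d_pt_id1 | apply continuity_2d_pt_id2 ].
  - apply filter_forall; intros y. apply ex_RInt_gauss_polar.
Qed.

(** The exponential factors as [gauss x * gauss (x * t)], and the substitution s = x t turns the
    second factor into [gauss_prim x]. *)
Lemma RInt_gauss_polar_deriv (x : R) :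
  RInt (fun t => - 2 * x * exp (- (x ^ 2) * (1 + t ^ 2) / 2)) 0 1
  = - 2 * gauss x * gauss_prim x.
Proof.
  rewrite (RInt_ext _ (fun t => scal (-2 * gauss x) (scal x (gauss (x * t + 0))))).
  2: { intros t _. unfold scal; simpl; unfold mult; simpl. unfold gauss.
       rewrite Rplus_0_r.
       replace (- (x * (x * 1)) * (1 + t * (t * 1)) / 2)
         with (- (x ^ 2) / 2 + - ((x * t) ^ 2) / 2) by (simpl; field).
       rewrite exp_plus. ring. }
  etransitivity.
  { apply (RInt_scal (fun t => scal x (gauss (x * t + 0))) 0 1).
    apply (ex_RInt_comp_lin gauss). apply ex_RInt_gauss. }
  unfold scal at 1; simpl; unfold mult; simpl. f_equal.
  etransitivity.
  { apply (RInt_comp_lin gauss x 0 0 1). apply ex_RInt_gauss. }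
  rewrite !Rplus_0_r, Rmult_0_r, Rmult_1_r. reflexivity.
Qed.

Lemma RInt_gauss_polar_0 : RInt (gauss_polar 0) 0 1 = PI / 2.
Proof.
  rewrite (RInt_ext _ (fun t => 2 * / (1 + t ^ 2))).
  2: { intros t _. unfold gauss_polar. replace (- 0 ^ 2 * (1 + t ^ 2) / 2) with 0 by field.
       rewrite exp_0, Rmult_1_r. reflexivity. }
  apply is_RInt_unique.
  replace (PI / 2) with (minus (2 * atan 1) (2 * atan 0)).
  2: { rewrite atan_0, atan_1. unfold minus, plus, opp; simpl. field. }
  apply (is_RInt_derive (fun t => 2 * atan t)).
  - intros t _. apply is_derive_scal. apply is_derive_Reals. apply derivable_pt_lim_atan.
  - intros t _. apply (ex_derive_continuous (fun t => 2 * / (1 + t ^ 2))). auto_derive. nra.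
Qed.

(** Makes the integral of [gauss_polar x] vanish at infinity at an explicit rate, which yields the
    value of the Gaussian integral. *)
Lemma RInt_gauss_polar_bound (x : R) :
  0 <= RInt (gauss_polar x) 0 1 <= 2 * gauss x.
Proof.
  assert (hp : forall t, 0 <= gauss_polar x t <= 2 * gauss x).
  { intros t. unfold gauss_polar, gauss.
    assert (h1 : 0 < / (1 + t ^ 2) <= 1).
    { split; [apply Rinv_0_lt_compat; nra|].
      rewrite <- Rinv_1 at 2. apply Rinv_le_contravar; nra. }
    assert (h2 : exp (- x ^ 2 * (1 + t ^ 2) / 2) <= exp (- x ^ 2 / 2)).
    { destruct (Req_dec (x * t) 0) as [e|e].
      - right. f_equal. replace (- x ^ 2 * (1 + t ^ 2) / 2) with (- x ^ 2 / 2 - (x * t) * (x * t) / 2) by field.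
        rewrite e. field.
      - left. apply exp_increasing. nra. }
    pose proof (exp_pos (- x ^ 2 * (1 + t ^ 2) / 2)).
    unfold Rdiv at 1 3. split; nra. }
  split.
  - apply RInt_ge_0; [lra | apply ex_RInt_gauss_polar | intros; apply hp].
  - replace (2 * gauss x) with (RInt (fun _ => 2 * gauss x) 0 1).
    2: { rewrite RInt_const. unfold scal; simpl; unfold mult; simpl. ring. }
    apply RInt_le; [lra | apply ex_RInt_gauss_polar | apply ex_RInt_const | intros; apply hp].
Qed.

(* The derivative of the left-hand side vanishes. *)
Lemma gauss_prim_sqr (x : R) : 0 <= x ->
  gauss_prim x ^ 2 + RInt (gauss_polar x) 0 1 = PI / 2.
Proof.
  intros hx. rewrite <- RInt_gauss_polar_0.
  set (f := fun x => gauss_prim x ^ 2 + RInt (gauss_polar x) 0 1).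
  assert (hd : forall y, is_derive f y 0).
  { intros y. unfold f. evar_last.
    - apply (is_derive_plus (fun x => gauss_prim x ^ 2)).
      + apply (is_derive_pow gauss_prim 2). apply is_derive_gauss_prim.
      + apply is_derive_RInt_gauss_polar.
    - rewrite RInt_gauss_polar_deriv. unfold plus; simpl. ring. }
  assert (h0 : f 0 = RInt (gauss_polar 0) 0 1).
  { unfold f. rewrite gauss_prim_0. ring. }
  rewrite <- h0. change (f x = f 0). apply Rle_antisym.
  - apply Ropp_le_cancel.
    apply (is_derive_incr (fun y => - f y) (fun _ => - 0) 0 x); [lra| |intros; lra].
    intros y _. apply (is_derive_opp f y 0), hd.
  - apply (is_derive_incr f (fun _ => 0) 0 x); [lra| |intros; lra]. intros; apply hd.
Qed.

Lemma exp_ge_1 (x : R) : 1 + x <= exp x.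
Proof.
  destruct (Req_dec x 0) as [->|e]; [rewrite exp_0; lra|].
  left. now apply exp_ineq1.
Qed.

Lemma gauss_le (x : R) : 0 < x -> gauss x <= 2 / x ^ 2.
Proof.
  intros hx. unfold gauss. replace (- x ^ 2 / 2) with (- (x ^ 2 / 2)) by field.
  rewrite exp_Ropp.
  replace (2 / x ^ 2) with (/ (x ^ 2 / 2)) by (field; lra).
  apply Rinv_le_contravar; [apply Rdiv_lt_0_compat; nra|].
  pose proof (exp_ge_1 (x ^ 2 / 2)). lra.
Qed.

(** The constant is the Gaussian integral over the half-line from 0, so this is the improper
    integral from x to infinity in a form that can be differentiated. *)
Definition ctail (x : R) : R := sqrt (PI / 2) - gauss_prim x.

(** With s = [sqrt (PI / 2)] and p = [gauss_prim x], the polar identity puts (s - p)(s + p) between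
    0 and [2 * gauss x], while s + p is at least 1. *)
Lemma ctail_bounds (x : R) : 0 < x -> 0 <= ctail x <= 4 / x ^ 2.
Proof.
  intros hx. unfold ctail.
  pose proof (gauss_prim_sqr x (Rlt_le _ _ hx)) as h.
  pose proof (RInt_gauss_polar_bound x) as [h1 h2].
  pose proof (gauss_le x hx) as h3.
  pose proof (gauss_prim_pos x (Rlt_le _ _ hx)) as h4.
  pose proof PI2_1 as hpi.
  assert (hs : 1 <= sqrt (PI / 2)).
  { rewrite <- sqrt_1 at 1. apply sqrt_le_1_alt. lra. }
  assert (hs2 : sqrt (PI / 2) * sqrt (PI / 2) = PI / 2) by (apply sqrt_sqrt; lra).
  replace (4 / x ^ 2) with (2 * (2 / x ^ 2)) by (field; lra).
  set (s := sqrt (PI / 2)) in *. set (p := gauss_prim x) in *.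
  split; nra.
Qed.

Lemma is_gauss_tail_ctail (x : R) : is_gauss_tail x (ctail x).
Proof.
  intros eps he.
  exists (1 + 4 / eps). intros b hb pr.
  rewrite <- RInt_Reals.
  assert (hb0 : 0 < 4 / eps) by (apply Rdiv_lt_0_compat; lra).
  assert (e : RInt gauss x b = gauss_prim b - gauss_prim x).
  { pose proof (RInt_Chasles gauss 0 x b (ex_RInt_gauss _ _) (ex_RInt_gauss _ _)) as h.
    change (gauss_prim x + RInt gauss x b = gauss_prim b) in h. lra. }
  rewrite e. unfold ctail.
  destruct (ctail_bounds b ltac:(lra)) as [h1 h2]. unfold ctail in h1, h2.
  assert (4 / b ^ 2 < eps).
  { apply Rlt_div_l; [nra|].
    assert (4 / eps * eps = 4) by (field; lra). nra. }
  apply Rabs_def1; lra.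
Qed.

(** The value chosen by [epsilon] is a limit because [ctail x] is one, and limits are unique. *)
Lemma gauss_tail_ctail (x : R) : gauss_tail x = ctail x.
Proof.
  unfold gauss_tail.
  pose proof (epsilon_spec (inhabits 0) (fun I => is_gauss_tail x I)
    (ex_intro _ _ (is_gauss_tail_ctail x))) as h. cbv beta in h.
  set (I := epsilon _ _) in *.
  apply cond_eq. intros eps he.
  destruct (h (eps / 2) ltac:(lra)) as [B1 h1].
  destruct (is_gauss_tail_ctail x (eps / 2) ltac:(lra)) as [B2 h2].
  set (b := Rmax B1 B2).
  assert (pr : Riemann_integrable gauss x b) by apply ex_RInt_Reals_0, ex_RInt_gauss.
  specialize (h1 b (Rmax_l _ _) pr). specialize (h2 b (Rmax_r _ _) pr).
  apply Rabs_def2 in h1. apply Rabs_def2 in h2. apply Rabs_def1; lra.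
Qed.

(** * The normal tail and the inverse of q *)

Lemma is_derive_gauss (x : R) : is_derive gauss x (- x * gauss x).
Proof.
  unfold gauss. evar_last; [auto_derive; [trivial|reflexivity]|]. simpl.
  replace (- (x * (x * 1)) * / 2) with (- (x * (x * 1)) / 2) by field. field.
Qed.

Lemma gauss_pos (x : R) : 0 < gauss x.
Proof. apply exp_pos. Qed.

Lemma is_derive_ctail (x : R) : is_derive ctail x (- gauss x).
Proof.
  unfold ctail. evar_last.
  - apply (is_derive_minus (fun _ => sqrt (PI / 2)) gauss_prim).
    + apply is_derive_const.
    + apply is_derive_gauss_prim.
  - unfold minus, plus, opp, zero; simpl. ring.
Qed.

(** A decreasing function whose lower limit at infinity is nonnegative is nonnegative. The rate 4 /
    x^2 is the one available from [ctail_bounds]. *)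
Lemma nonneg_of_decr (f df : R -> R) (a : R) :
  (forall x, a <= x -> is_derive f x (df x)) ->
  (forall x, a <= x -> df x <= 0) ->
  (forall x, 0 < x -> a <= x -> - (4 / x ^ 2) <= f x) ->
  0 <= f a.
Proof.
  intros hd hn hl. apply le_epsilon. intros eps he.
  set (b := Rmax a (1 + 4 / eps)).
  assert (hb0 : 0 < 4 / eps) by (apply Rdiv_lt_0_compat; lra).
  assert (hb : 1 + 4 / eps <= b) by apply Rmax_r.
  assert (hab : a <= b) by apply Rmax_l.
  assert (4 / b ^ 2 < eps).
  { apply Rlt_div_l; [nra|].
    assert (4 / eps * eps = 4) by (field; lra). nra. }
  pose proof (hl b ltac:(lra) hab).
  assert (- f a <= - f b).
  { apply (is_derive_incr (fun y => - f y) (fun y => - df y) a b); [lra| |].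
    - intros x hx. apply (is_derive_opp f x (df x)). apply hd; lra.
    - intros x hx. pose proof (hn x ltac:(lra)). lra. }
  lra.
Qed.

(** A Mills ratio bound: the difference of the two sides decreases, and it tends to 0 at
    infinity. *)
Lemma ctail_lower (x : R) : 0 <= x -> gauss x / (x + 1) <= ctail x.
Proof.
  intros hx. apply Rminus_le_0.
  apply (nonneg_of_decr (fun x => ctail x - gauss x / (x + 1))
           (fun x => - (gauss x * x / (x + 1) ^ 2)) x).
  - intros y hy. evar_last.
    + apply (is_derive_minus ctail (fun x => gauss x / (x + 1))).
      * apply is_derive_ctail.
      * apply (is_derive_div gauss (fun x => x + 1) y (- y * gauss y) 1);
          [apply is_derive_gauss | auto_derive; [trivial|ring] | lra].
    + unfold minus, plus, opp; simpl. field. lra.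
  - intros y hy. assert (0 <= gauss y * y / (y + 1) ^ 2); [|lra].
    apply Rmult_le_pos.
    + apply Rmult_le_pos; [apply Rlt_le, gauss_pos | lra].
    + apply Rlt_le, Rinv_0_lt_compat. nra.
  - intros y hy0 hy. destruct (ctail_bounds y hy0) as [h _].
    pose proof (gauss_le y hy0) as h1.
    assert (gauss y / (y + 1) <= gauss y).
    { apply Rle_div_l; [lra|]. pose proof (gauss_pos y). nra. }
    assert (4 / y ^ 2 = 2 * (2 / y ^ 2)) by (field; lra).
    assert (0 < 2 / y ^ 2) by (apply Rdiv_lt_0_compat; nra). lra.
Qed.

Lemma ctail_pos (x : R) : 0 <= x -> 0 < ctail x.
Proof.
  intros hx. apply Rlt_le_trans with (gauss x / (x + 1)); [|now apply ctail_lower].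
  apply Rdiv_lt_0_compat; [apply gauss_pos | lra].
Qed.

Lemma ctail_0 : ctail 0 = sqrt (PI / 2).
Proof. unfold ctail. rewrite gauss_prim_0. ring. Qed.

Lemma sqrt_PI2_pos : 0 < sqrt (PI / 2).
Proof. apply sqrt_lt_R0. pose proof PI_RGT_0. lra. Qed.

(* The difference of the two sides vanishes at 0 and at infinity; it increases
   up to x = 1 / sqrt (PI / 2) and decreases afterwards. *)
Lemma ctail_upper (x : R) : 0 <= x -> ctail x <= sqrt (PI / 2) * gauss x.
Proof.
  intros hx. apply Rminus_le_0.
  pose proof sqrt_PI2_pos as hs. set (s := sqrt (PI / 2)) in *.
  set (h := fun x => s * gauss x - ctail x).
  assert (hd : forall y, is_derive h y (gauss y * (1 - s * y))).
  { intros y. unfold h. evar_last.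
    - apply (is_derive_minus (fun x => s * gauss x) ctail).
      + apply (is_derive_scal gauss), is_derive_gauss.
      + apply is_derive_ctail.
    - unfold minus, plus, opp; simpl. ring. }
  assert (h0 : h 0 = 0).
  { unfold h. rewrite ctail_0. fold s. unfold gauss.
    replace (- 0 ^ 2 / 2) with 0 by field. rewrite exp_0. ring. }
  change (0 <= h x).
  destruct (Rle_lt_dec (s * x) 1) as [hc|hc].
  - rewrite <- h0.
    apply (is_derive_incr h (fun y => gauss y * (1 - s * y))); [exact hx | intros; apply hd|].
    intros y hy. apply Rmult_le_pos; [apply Rlt_le, gauss_pos | nra].
  - apply (nonneg_of_decr h (fun y => gauss y * (1 - s * y))); [intros; apply hd| |].
    + intros y hy. pose proof (gauss_pos y). assert (1 - s * y <= 0) by nra. nra.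
    + intros y hy0 hy. unfold h. pose proof (ctail_bounds y hy0).
      pose proof (gauss_pos y). nra.
Qed.

Definition Qf (x : R) : R := ctail x / sqrt (2 * PI).

Definition gdens (x : R) : R := gauss x / sqrt (2 * PI).

Lemma sqrt_2PI : sqrt (2 * PI) = 2 * sqrt (PI / 2).
Proof.
  replace (2 * PI) with (Rsqr 2 * (PI / 2)) by (unfold Rsqr; field).
  pose proof PI_RGT_0. rewrite sqrt_mult_alt by (unfold Rsqr; lra).
  now rewrite sqrt_Rsqr by lra.
Qed.

Lemma sqrt_2PI_pos : 0 < sqrt (2 * PI).
Proof. apply sqrt_lt_R0. pose proof PI_RGT_0. lra. Qed.

Lemma is_derive_Qf (x : R) : is_derive Qf x (- gdens x).
Proof.
  unfold Qf. evar_last.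
  - apply (is_derive_ext (fun x => / sqrt (2 * PI) * ctail x)).
    + intros t. apply Rmult_comm.
    + apply (is_derive_scal ctail), is_derive_ctail.
  - unfold gdens, Rdiv. ring.
Qed.

Lemma is_derive_gdens (x : R) : is_derive gdens x (- x * gdens x).
Proof.
  unfold gdens. evar_last.
  - apply (is_derive_ext (fun x => / sqrt (2 * PI) * gauss x)).
    + intros t. apply Rmult_comm.
    + apply (is_derive_scal gauss), is_derive_gauss.
  - unfold Rdiv. ring.
Qed.

Lemma gdens_pos (x : R) : 0 < gdens x.
Proof. apply Rdiv_lt_0_compat; [apply gauss_pos | apply sqrt_2PI_pos]. Qed.

Lemma Qf_0 : Qf 0 = / 2.
Proof.
  unfold Qf. rewrite ctail_0, sqrt_2PI. pose proof sqrt_PI2_pos. field. lra.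
Qed.

Lemma gdens_0 : gdens 0 = / sqrt (2 * PI).
Proof.
  unfold gdens, gauss. replace (- 0 ^ 2 / 2) with 0 by field. rewrite exp_0.
  unfold Rdiv. ring.
Qed.

Lemma Qf_pos (x : R) : 0 <= x -> 0 < Qf x.
Proof. intros hx. apply Rdiv_lt_0_compat; [now apply ctail_pos | apply sqrt_2PI_pos]. Qed.

Lemma Qf_lower (x : R) : 0 <= x -> gdens x <= (x + 1) * Qf x.
Proof.
  intros hx. unfold gdens, Qf, Rdiv. rewrite <- Rmult_assoc.
  apply Rmult_le_compat_r; [apply Rlt_le, Rinv_0_lt_compat, sqrt_2PI_pos|].
  pose proof (ctail_lower x hx) as h. apply Rle_div_l in h; lra.
Qed.

Lemma Qf_upper (x : R) : 0 <= x -> Qf x <= gauss x / 2.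
Proof.
  intros hx. unfold Qf. rewrite sqrt_2PI. pose proof sqrt_PI2_pos.
  apply Rle_div_l; [lra|]. pose proof (ctail_upper x hx). lra.
Qed.

Lemma Qf_decr_strict (x y : R) : x < y -> Qf y < Qf x.
Proof.
  intros h. apply Ropp_lt_cancel.
  apply (incr_function_le (fun x => - Qf x) x y gdens); try (simpl; lra).
  - intros z _ _. evar_last; [apply (is_derive_opp Qf), is_derive_Qf|].
    unfold opp; simpl. ring.
  - intros z _ _. apply gdens_pos.
Qed.

Lemma ln_sqrt_half (x : R) : 0 < x -> ln (sqrt x) = ln x / 2.
Proof.
  intros hx. rewrite <- (sqrt_sqrt x) at 2 by lra.
  rewrite ln_mult by now apply sqrt_lt_R0. field.
Qed.

(** The factor [exp (x ^ 2 / 2)] in [Ymills] cancels the quadratic term, and the constant is the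
    logarithm of [sqrt (2 * PI)]. *)
Lemma qfun_Qf (x : R) : 0 <= x -> qfun x = - ln (Qf x).
Proof.
  intros hx. unfold qfun, Ymills, Qf. rewrite gauss_tail_ctail.
  pose proof (ctail_pos x hx). pose proof sqrt_2PI_pos.
  pose proof (exp_pos (x ^ 2 / 2)). pose proof PI_RGT_0.
  rewrite (ln_mult (exp (x ^ 2 / 2))), ln_exp by assumption.
  rewrite ln_div by assumption. rewrite ln_sqrt_half by lra.
  field.
Qed.

Lemma Qf_surj (y : R) : 0 < y < / 2 -> exists x, 0 <= x /\ Qf x = y.
Proof.
  intros hy.
  assert (hb : exists b, 0 < b /\ Qf b < y).
  { exists (1 + 1 / y). assert (h1 : 0 < 1 / y) by (apply Rdiv_lt_0_compat; lra).
    split; [lra|].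
    pose proof (Qf_upper (1 + 1 / y) ltac:(lra)) as h2.
    pose proof (gauss_le (1 + 1 / y) ltac:(lra)) as h3.
    assert (2 / (1 + 1 / y) ^ 2 < 2 * y); [|lra].
    apply Rlt_div_l; [nra|].
    assert (y * (1 / y) = 1) by (field; lra). nra. }
  destruct hb as [b [hb0 hb]].
  destruct (IVT_gen Qf 0 b y) as [x [hx e]].
  - intros x. apply derivable_continuous_pt. exists (- gdens x).
    apply is_derive_Reals, is_derive_Qf.
  - rewrite Qf_0. split; [eapply Rle_trans; [apply Rmin_r|lra] | eapply Rle_trans; [|apply Rmax_l]; lra].
  - exists x. rewrite Rmin_left in hx by lra. split; [lra|exact e].
Qed.

Lemma max0_qinv_spec (y : R) : ln 2 < y ->
  0 <= max0_qinv y /\ Qf (max0_qinv y) = exp (- y).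
Proof.
  intros hy. unfold max0_qinv. destruct (Rle_dec y (ln 2)) as [h|_]; [lra|].
  assert (hex : exists x, 0 <= x /\ qfun x = y).
  { destruct (Qf_surj (exp (- y))) as [x [hx e]].
    - split; [apply exp_pos|].
      rewrite <- (exp_ln (/ 2)) by lra. apply exp_increasing.
      rewrite ln_Rinv by lra. lra.
    - exists x. split; [exact hx|]. rewrite qfun_Qf by exact hx. rewrite e, ln_exp. ring. }
  pose proof (epsilon_spec (inhabits 0) (fun x => 0 <= x /\ qfun x = y) hex) as [h1 h2].
  split; [exact h1|]. rewrite qfun_Qf in h2 by exact h1.
  replace (- y) with (ln (Qf (epsilon (inhabits 0) (fun x => 0 <= x /\ qfun x = y)))) by lra.
  symmetry. apply exp_ln. now apply Qf_pos.
Qed.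

(** Together with [max0_qinv_ge], turns bounds on the inverse of q into bounds on Q. For y <= log 2
    the default value 0 satisfies the claim because x >= 0. *)
Lemma max0_qinv_le (x y : R) : 0 <= x -> Qf x <= exp (- y) -> max0_qinv y <= x.
Proof.
  intros hx h. destruct (Rle_lt_dec y (ln 2)) as [hy|hy].
  - unfold max0_qinv. destruct (Rle_dec y (ln 2)); lra.
  - destruct (max0_qinv_spec y hy) as [h1 h2]. apply Rnot_lt_le. intros hlt.
    apply Qf_decr_strict in hlt. lra.
Qed.

Lemma max0_qinv_ge (x y : R) : ln 2 < y -> exp (- y) <= Qf x -> x <= max0_qinv y.
Proof.
  intros hy h. destruct (max0_qinv_spec y hy) as [h1 h2].
  apply Rnot_lt_le. intros hlt. apply Qf_decr_strict in hlt. lra.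
Qed.

(** * Relative entropy *)

(** The entropy bounds below are equalities at [phi = th], so each follows from the sign of a
    derivative to the left of [th]. *)
Lemma is_derive_decr_to_0 (f df : R -> R) (a b : R) :
  a <= b ->
  (forall x, a <= x <= b -> is_derive f x (df x)) ->
  (forall x, a <= x <= b -> df x <= 0) ->
  f b = 0 -> 0 <= f a.
Proof.
  intros hab hd hn hb.
  assert (- f a <= - f b); [|lra].
  apply (is_derive_incr (fun y => - f y) (fun y => - df y) a b); [lra| |].
  - intros x hx. apply (is_derive_opp f x (df x)). apply hd; lra.
  - intros x hx. pose proof (hn x ltac:(lra)). lra.
Qed.

Lemma mult_diff_nonpos (d x y : R) : 0 <= d -> x <= y -> d * (x - y) <= 0.
Proof. intros hd h. nra. Qed.

Lemma le_div_of_mul (a b c : R) : 0 < c -> a * c <= b -> a <= b / c.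
Proof. intros hc. now apply Rle_div_r. Qed.

Lemma div_le_of_mul (a b c : R) : 0 < c -> a <= b * c -> a / c <= b.
Proof. intros hc. now apply Rle_div_l. Qed.

Lemma exp_ge_2 (x : R) : 0 <= x -> 1 + x + x ^ 2 / 2 <= exp x.
Proof.
  intros hx.
  pose proof (is_derive_incr (fun y => exp y - (1 + y + y ^ 2 / 2)) (fun y => exp y - (1 + y)) 0 x hx) as h.
  cbv beta in h. rewrite exp_0 in h.
  assert (1 - (1 + 0 + 0 ^ 2 / 2) <= exp x - (1 + x + x ^ 2 / 2)); [|lra].
  apply h.
  - intros y _. auto_derive; [trivial|field].
  - intros y _. pose proof (exp_ge_1 y). lra.
Qed.

Lemma exp_opp_le_2 (x : R) : 0 <= x -> exp (- x) <= 1 - x + x ^ 2 / 2.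
Proof.
  intros hx.
  pose proof (is_derive_incr (fun y => 1 - y + y ^ 2 / 2 - exp (- y))
    (fun y => - 1 + y + exp (- y)) 0 x hx) as h.
  cbv beta in h. rewrite Ropp_0, exp_0 in h.
  assert (1 - 0 + 0 ^ 2 / 2 - 1 <= 1 - x + x ^ 2 / 2 - exp (- x)); [|lra].
  apply h.
  - intros y _. auto_derive; [trivial|field].
  - intros y _. pose proof (exp_ge_1 (- y)). lra.
Qed.

Definition kl (th phi : R) : R :=
  th * (ln th - ln phi) + (1 - th) * (ln (1 - th) - ln (1 - phi)).

(** Exchanging success and failure carries the bounds for [phi <= th] over to [phi >= th]. *)
Lemma kl_sym (th phi : R) : kl (1 - th) (1 - phi) = kl th phi.
Proof.
  unfold kl. replace (1 - (1 - th)) with th by ring.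
  replace (1 - (1 - phi)) with phi by ring. ring.
Qed.

Lemma kl_diag (th : R) : kl th th = 0.
Proof. unfold kl. ring. Qed.

Lemma is_derive_kl (th phi : R) : 0 < phi < 1 ->
  is_derive (kl th) phi ((phi - th) / (phi * (1 - phi))).
Proof. intros h. unfold kl. auto_derive; [lra|field; lra]. Qed.

(** The derivative comparison reduces to p (1 - th)^2 <= th (1 - p)^2. The right-hand shape is a
    square so that its root bounds [dev] in exactly the form that fixes the sign of the derivative
    of [gap]; [kl_upper] is built likewise. *)
Lemma kl_lower (th phi : R) : 0 < phi <= th -> th < 1 ->
  (1 - th) / th * ((th - phi) / (1 - phi)) ^ 2 <= 2 * kl th phi.
Proof.
  intros h1 h2. apply Rminus_le_0.
  apply (is_derive_decr_to_0
    (fun p => 2 * kl th p - (1 - th) / th * ((th - p) / (1 - p)) ^ 2)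
    (fun p => 2 * (th - p) * ((1 - th) ^ 2 / (th * (1 - p) ^ 3) - 1 / (p * (1 - p)))) phi th); [lra| | |].
  - intros p hp. evar_last.
    + apply (is_derive_minus (fun p => 2 * kl th p) (fun p => (1 - th) / th * ((th - p) / (1 - p)) ^ 2)).
      * apply (is_derive_scal (kl th)), is_derive_kl. lra.
      * auto_derive; [lra|reflexivity].
    + unfold minus, plus, opp; simpl. field. lra.
  - intros p hp. assert ((1 - th) ^ 2 / (th * (1 - p) ^ 3) <= 1 / (p * (1 - p))); [|apply mult_diff_nonpos; lra].
    assert (0 < th * (1 - p) ^ 3) by (apply Rmult_lt_0_compat; [lra|apply pow_lt; lra]).
    apply div_le_of_mul; [assumption|].
    replace (1 / (p * (1 - p)) * (th * (1 - p) ^ 3)) with (th * (1 - p) ^ 2 / p) by (field; lra).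
    apply le_div_of_mul; [lra|].
    assert ((1 - th) ^ 2 <= (1 - p) ^ 2) by (apply pow_incr; lra).
    rewrite (Rmult_comm th).
    apply Rmult_le_compat; [apply pow2_ge_0 | lra | assumption | lra].
  - rewrite kl_diag. unfold Rdiv. ring.
Qed.

Lemma kl_upper (th phi : R) : 0 < phi <= th -> th < 1 ->
  2 * kl th phi <= th / (1 - th) * ((th - phi) / phi) ^ 2.
Proof.
  intros h1 h2. apply Rminus_le_0.
  apply (is_derive_decr_to_0
    (fun p => th / (1 - th) * ((th - p) / p) ^ 2 - 2 * kl th p)
    (fun p => 2 * (th - p) * (1 / (p * (1 - p)) - th ^ 2 / ((1 - th) * p ^ 3))) phi th); [lra| | |].
  - intros p hp. evar_last.
    + apply (is_derive_minus (fun p => th / (1 - th) * ((th - p) / p) ^ 2) (fun p => 2 * kl th p)).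
      * auto_derive; [lra|reflexivity].
      * apply (is_derive_scal (kl th)), is_derive_kl. lra.
    + unfold minus, plus, opp; simpl. field. lra.
  - intros p hp. assert (1 / (p * (1 - p)) <= th ^ 2 / ((1 - th) * p ^ 3)); [|apply mult_diff_nonpos; lra].
    assert (0 < p * (1 - p)) by nra.
    assert (0 < p ^ 3) by (apply pow_lt; lra).
    apply div_le_of_mul; [assumption|].
    replace (th ^ 2 / ((1 - th) * p ^ 3) * (p * (1 - p))) with (th ^ 2 * (1 - p) / ((1 - th) * p ^ 2)) by (field; lra).
    apply le_div_of_mul; [nra|].
    assert (p ^ 2 <= th ^ 2) by (apply pow_incr; lra).
    pose proof (pow2_ge_0 p). pose proof (pow2_ge_0 th). nra.
  - rewrite kl_diag. unfold Rdiv. ring.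
Qed.

(** The derivative of the entropy is (p - th) divided by the variance p (1 - p), which exceeds s =
    th (1 - th) by at most th - p. Replacing it by s + (th - p) gives an integral that is an
    explicit logarithm. *)
Lemma kl_log_lower (th phi : R) : 0 < phi <= th -> th < 1 ->
  th - phi - th * (1 - th) * ln (1 + (th - phi) / (th * (1 - th))) <= kl th phi.
Proof.
  intros h1 h2. apply Rminus_le_0.
  assert (hs : 0 < th * (1 - th)) by nra. set (s := th * (1 - th)) in *.
  apply (is_derive_decr_to_0
    (fun p => kl th p - (th - p - s * ln (1 + (th - p) / s)))
    (fun p => (th - p) * (1 / (s + (th - p)) - 1 / (p * (1 - p)))) phi th); [lra| | |].
  - intros p hp.
    assert (0 <= (th - p) / s) by (apply Rdiv_le_0_compat; lra). evar_last.
    + apply (is_derive_minus (kl th) (fun p => th - p - s * ln (1 + (th - p) / s))).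
      * apply is_derive_kl. lra.
      * auto_derive; [unfold Rdiv, Rminus in *; lra|reflexivity].
    + unfold minus, plus, opp; simpl. field. repeat split; lra.
  - intros p hp.
    assert (1 / (s + (th - p)) <= 1 / (p * (1 - p))); [|apply mult_diff_nonpos; lra].
    unfold Rdiv; rewrite !Rmult_1_l. apply Rinv_le_contravar; [nra|]. unfold s. nra.
  - rewrite kl_diag. unfold Rdiv. rewrite (Rminus_diag th), Rmult_0_l, Rplus_0_r, ln_1. ring.
Qed.

(** Here the variance p (1 - p) is bounded below by s - (th - p), which the last hypothesis keeps
    positive. *)
Lemma kl_log_upper (th phi : R) : 0 < phi <= th -> th < 1 -> (th - phi) / (th * (1 - th)) < 1 ->
  kl th phi <= - (th - phi) - th * (1 - th) * ln (1 - (th - phi) / (th * (1 - th))).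
Proof.
  intros h1 h2 h3. apply Rminus_le_0.
  assert (hs : 0 < th * (1 - th)) by nra.
  assert (h4 : th - phi < th * (1 - th)) by (apply Rlt_div_l in h3; lra).
  clear h3. assert (es : th * (1 - th) = th - th ^ 2) by ring.
  set (s := th * (1 - th)) in *.
  apply (is_derive_decr_to_0
    (fun p => - (th - p) - s * ln (1 - (th - p) / s) - kl th p)
    (fun p => (th - p) * (1 / (p * (1 - p)) - 1 / (s - (th - p)))) phi th); [lra| | |].
  - intros p hp.
    assert ((th - p) / s < 1) by (apply Rlt_div_l; lra). evar_last.
    + apply (is_derive_minus (fun p => - (th - p) - s * ln (1 - (th - p) / s)) (kl th)).
      * auto_derive; [unfold Rdiv, Rminus in *; lra|reflexivity].
      * apply is_derive_kl. lra.
    + unfold minus, plus, opp; simpl. field. repeat split; lra.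
  - intros p hp.
    assert (1 / (p * (1 - p)) <= 1 / (s - (th - p))); [|apply mult_diff_nonpos; lra].
    unfold Rdiv; rewrite !Rmult_1_l. apply Rinv_le_contravar; nra.
  - rewrite kl_diag. unfold Rdiv. rewrite (Rminus_diag th), Rmult_0_l, (Rminus_0_r 1), ln_1. ring.
Qed.

(** This is u = x / r of the overview: n cancels between x = sqrt (2 n H) and r. *)
Definition dev (th phi : R) : R := sqrt (2 * kl th phi / (th * (1 - th))).

Lemma dev_sym (th phi : R) : dev (1 - th) (1 - phi) = dev th phi.
Proof. unfold dev. rewrite kl_sym. do 2 f_equal. ring. Qed.

Lemma dev_diag (th : R) : dev th th = 0.
Proof. unfold dev. rewrite kl_diag. unfold Rdiv. rewrite Rmult_0_r, Rmult_0_l. apply sqrt_0. Qed.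

Lemma dev_pos (th phi : R) : 0 <= dev th phi.
Proof. apply sqrt_pos. Qed.

Lemma dev_lower_left (th phi : R) : 0 < phi <= th -> th < 1 ->
  (th - phi) / (th * (1 - phi)) <= dev th phi.
Proof.
  intros h1 h2. unfold dev.
  assert (h0 : 0 <= (th - phi) / (th * (1 - phi))) by (apply Rdiv_le_0_compat; nra).
  rewrite <- (sqrt_Rsqr _ h0). apply sqrt_le_1_alt.
  apply le_div_of_mul; [nra|]. eapply Rle_trans; [|apply kl_lower; assumption].
  right. unfold Rsqr. field. lra.
Qed.

Lemma dev_upper_left (th phi : R) : 0 < phi <= th -> th < 1 ->
  dev th phi <= (th - phi) / (phi * (1 - th)).
Proof.
  intros h1 h2. unfold dev.
  assert (h0 : 0 <= (th - phi) / (phi * (1 - th))) by (apply Rdiv_le_0_compat; nra).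
  rewrite <- (sqrt_Rsqr _ h0). apply sqrt_le_1_alt.
  apply div_le_of_mul; [nra|]. eapply Rle_trans; [apply kl_upper; assumption|].
  right. unfold Rsqr. field. lra.
Qed.

Lemma dev_lower_right (th phi : R) : 0 < th <= phi -> phi < 1 ->
  (phi - th) / (phi * (1 - th)) <= dev th phi.
Proof.
  intros h1 h2. rewrite <- dev_sym.
  eapply Rle_trans; [|apply dev_lower_left; lra]. right. field. lra.
Qed.

Lemma dev_upper_right (th phi : R) : 0 < th <= phi -> phi < 1 ->
  dev th phi <= (phi - th) / (th * (1 - phi)).
Proof.
  intros h1 h2. rewrite <- dev_sym.
  eapply Rle_trans; [apply dev_upper_left; lra|]. right. field. lra.
Qed.

Lemma kl_pos (th phi : R) : 0 < th < 1 -> 0 < phi < 1 -> phi <> th -> 0 < kl th phi.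
Proof.
  assert (hlt : forall th phi, 0 < phi < th -> th < 1 -> 0 < kl th phi).
  { clear. intros th phi h1 h2. pose proof (kl_lower th phi ltac:(lra) h2).
    assert (0 < (1 - th) / th * ((th - phi) / (1 - phi)) ^ 2); [|lra].
    apply Rmult_lt_0_compat; [|apply pow_lt]; apply Rdiv_lt_0_compat; lra. }
  intros h1 h2 h3. destruct (Rtotal_order phi th) as [h|[h|h]]; [apply hlt; lra|contradiction|].
  rewrite <- kl_sym. apply hlt; lra.
Qed.

Lemma dev_pos_strict (th phi : R) : 0 < th < 1 -> 0 < phi < 1 -> phi <> th -> 0 < dev th phi.
Proof.
  intros ht hp hne. apply sqrt_lt_R0. pose proof (kl_pos th phi ht hp hne).
  apply Rdiv_lt_0_compat; nra.
Qed.

Lemma kl_nonneg (th phi : R) : 0 < th < 1 -> 0 < phi < 1 -> 0 <= kl th phi.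
Proof.
  intros h1 h2. destruct (Req_dec phi th) as [->|h]; [rewrite kl_diag; lra|].
  now apply Rlt_le, kl_pos.
Qed.

Lemma dev_sqr (th phi : R) : 0 < th < 1 -> 0 < phi < 1 ->
  th * (1 - th) * dev th phi ^ 2 = 2 * kl th phi.
Proof.
  intros h1 h2. unfold dev. assert (0 < th * (1 - th)) by nra.
  replace (sqrt _ ^ 2) with (2 * kl th phi / (th * (1 - th))).
  - field. lra.
  - rewrite <- Rsqr_pow2, Rsqr_sqrt; [reflexivity|].
    apply Rdiv_le_0_compat; [|assumption]. pose proof (kl_nonneg th phi h1 h2). lra.
Qed.

Lemma ln_lt_minus_1 (y : R) : 0 < y -> y <> 1 -> ln y < y - 1.
Proof.
  intros h1 h2. pose proof (exp_ineq1 (ln y)) as h. rewrite exp_ln in h by exact h1.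
  assert (ln y <> 0).
  { intros e. apply h2. rewrite <- (exp_ln y) by exact h1. rewrite e. apply exp_0. }
  specialize (h H). lra.
Qed.

(* In terms of u = dev, kl_log_lower bounds w - ln (1 + w) by u^2 / 2, whereas
   v = u + u^2 / 2 satisfies v - ln (1 + v) >= u^2 / 2. *)
Lemma shift_upper (th phi : R) : 0 < phi <= th -> th < 1 ->
  (th - phi) / (th * (1 - th)) <= dev th phi * (1 + dev th phi / 2).
Proof.
  intros h1 h2. apply Rnot_lt_le. intros hlt.
  assert (hs : 0 < th * (1 - th)) by nra.
  pose proof (dev_pos th phi) as hu. pose proof (exp_ge_2 _ hu) as he.
  pose proof (dev_sqr th phi ltac:(lra) ltac:(lra)) as hd.
  pose proof (kl_log_lower th phi h1 h2) as hk.
  set (u := dev th phi) in *. set (w := (th - phi) / (th * (1 - th))) in *.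
  assert (ew : th - phi = th * (1 - th) * w) by (unfold w; field; lra).
  rewrite ew in hk. set (s := th * (1 - th)) in *.
  assert (hk' : w - ln (1 + w) <= u ^ 2 / 2) by nra.
  set (v := u * (1 + u / 2)) in *.
  assert (hv : 0 <= v) by (unfold v; nra).
  assert (hl : ln (1 + v) <= u).
  { rewrite <- (ln_exp u). apply ln_le; [lra|]. unfold v. lra. }
  assert (ht : ln ((1 + w) / (1 + v)) < (1 + w) / (1 + v) - 1).
  { apply ln_lt_minus_1; [apply Rdiv_lt_0_compat; lra|].
    intros e. apply (f_equal (fun z => z * (1 + v))) in e. field_simplify in e; lra. }
  rewrite ln_div in ht by lra.
  assert ((1 + w) / (1 + v) - 1 <= w - v).
  { replace ((1 + w) / (1 + v) - 1) with ((w - v) / (1 + v)) by (field; lra).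
    apply div_le_of_mul; nra. }
  assert (v = u + u ^ 2 / 2) by (unfold v; field). lra.
Qed.

(** With v = u - u^2/2, the bound e^(-u) <= 1 - v gives - v - ln (1 - v) <= u^2/2, while
    [kl_log_upper] gives - w - ln (1 - w) >= u^2/2. As - y - ln (1 - y) is strictly increasing on
    [0, 1), w < v is impossible. *)
Lemma shift_lower (th phi : R) : 0 < phi <= th -> th < 1 ->
  dev th phi * (1 - dev th phi / 2) <= (th - phi) / (th * (1 - th)).
Proof.
  intros h1 h2. apply Rnot_lt_le. intros hlt.
  assert (hs : 0 < th * (1 - th)) by nra.
  pose proof (dev_pos th phi) as hu. pose proof (exp_opp_le_2 _ hu) as he.
  pose proof (dev_sqr th phi ltac:(lra) ltac:(lra)) as hd.
  pose proof (kl_log_upper th phi h1 h2) as hk.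
  assert (hw : 0 <= (th - phi) / (th * (1 - th))) by (apply Rdiv_le_0_compat; lra).
  set (u := dev th phi) in *. set (w := (th - phi) / (th * (1 - th))) in *.
  assert (ew : th - phi = th * (1 - th) * w) by (unfold w; field; lra).
  rewrite ew in hk. set (s := th * (1 - th)) in *.
  set (v := u * (1 - u / 2)) in *.
  (* Under the contrary assumption w < v this forces w < 1, the condition of [kl_log_upper]. *)
  assert (hv : v <= 1 / 2) by (pose proof (pow2_ge_0 (u - 1)); unfold v; lra).
  assert (hw1 : w < 1) by lra. specialize (hk hw1).
  assert (hk' : u ^ 2 / 2 <= - w - ln (1 - w)) by nra.
  assert (hl : - u <= ln (1 - v)).
  { rewrite <- (ln_exp (- u)). apply ln_le; [apply exp_pos|]. unfold v. lra. }
  assert (ht : ln ((1 - v) / (1 - w)) < (1 - v) / (1 - w) - 1).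
  { apply ln_lt_minus_1; [apply Rdiv_lt_0_compat; lra|].
    intros e. apply (f_equal (fun z => z * (1 - w))) in e. field_simplify in e; lra. }
  rewrite ln_div in ht by lra.
  assert ((1 - v) / (1 - w) - 1 <= w - v).
  { replace ((1 - v) / (1 - w) - 1) with ((w - v) / (1 - w)) by (field; lra).
    apply div_le_of_mul; nra. }
  assert (v = u - u ^ 2 / 2) by (unfold v; field). lra.
Qed.

(** * The binomial tail *)

Definition bterm (n k : nat) (phi : R) : R :=
  Binomial.C n k * phi ^ k * (1 - phi) ^ (n - k).

(** The cut-off [N] is kept apart from [n] to allow induction on partial sums of a fixed binomial
    distribution. *)
Definition btail (n m N : nat) (phi : R) : R :=
  sum_f_R0 (fun k => if le_dec m k then bterm n k phi else 0) N.

Lemma binomial_absorb (n k : nat) : (k < n)%nat ->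
  INR (S k) * Binomial.C n (S k) = INR (n - k) * Binomial.C n k.
Proof.
  intros h. unfold Binomial.C.
  replace (n - k)%nat with (S (n - S k)) by lia.
  rewrite !fact_simpl, !mult_INR.
  field. repeat split; try apply INR_fact_neq_0; apply not_0_INR; lia.
Qed.

Lemma is_derive_bterm (n k : nat) (phi : R) :
  is_derive (bterm n k) phi
    (INR k * Binomial.C n k * phi ^ (k - 1) * (1 - phi) ^ (n - k)
     - INR (n - k) * Binomial.C n k * phi ^ k * (1 - phi) ^ (n - k - 1)).
Proof.
  unfold bterm. auto_derive; [trivial|].
  rewrite !Nat.sub_1_r. fold (phi - phi). fold (1 - phi). ring.
Qed.

(** By [binomial_absorb] the derivative of the k-th term is A(k) - A(k+1) with A(k) = k C(n,k)
    phi^(k-1) (1 - phi)^(n-k), so the sum telescopes. The upper boundary term carries the factor n -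
    N and disappears at N = n. *)
Lemma is_derive_btail_partial (n m N : nat) (phi : R) : (1 <= m)%nat -> (N <= n)%nat ->
  is_derive (btail n m N) phi
    (if le_dec m N then
       INR m * Binomial.C n m * phi ^ (m - 1) * (1 - phi) ^ (n - m)
       - INR (n - N) * Binomial.C n N * phi ^ N * (1 - phi) ^ (n - N - 1)
     else 0).
Proof.
  intros hm. induction N as [|N IH]; intros hN.
  - unfold btail; simpl sum_f_R0. destruct (le_dec m 0) as [h|h]; [lia|]. exact (is_derive_const (V := R_NormedModule) 0 phi).
  - specialize (IH ltac:(lia)).
    apply (is_derive_ext (fun p => btail n m N p + (if le_dec m (S N) then bterm n (S N) p else 0))).
    { reflexivity. }
    destruct (le_dec m (S N)) as [h|h].
    + evar_last; [apply (is_derive_plus (btail n m N)); [exact IH | apply is_derive_bterm]|].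
      rewrite binomial_absorb by lia. unfold plus; simpl.
      replace (N - 0)%nat with N by lia. replace (n - N - 1)%nat with (n - S N)%nat by lia.
      destruct (le_dec m N) as [h'|h'].
      * ring.
      (* The sum was empty so far: this term contributes both ends of the telescope. *)
      * assert (m = S N) by lia. subst m.
        rewrite binomial_absorb by lia. simpl. rewrite Nat.sub_0_r. ring.
    + evar_last; [apply (is_derive_plus (btail n m N)); [exact IH | exact (is_derive_const (V := R_NormedModule) 0 phi)]|].
      destruct (le_dec m N) as [h'|h']; [lia|]. unfold plus, zero; simpl. ring.
Qed.

Lemma is_derive_btail (n m : nat) (phi : R) : (1 <= m <= n)%nat ->
  is_derive (btail n m n) phi (INR m * Binomial.C n m * phi ^ (m - 1) * (1 - phi) ^ (n - m)).
Proof.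
  intros h. evar_last; [apply is_derive_btail_partial; lia|].
  destruct (le_dec m n) as [_|]; [|lia].
  rewrite Nat.sub_diag. simpl. ring.
Qed.

Lemma btail_0 (n m N : nat) : (1 <= m)%nat -> btail n m N 0 = 0.
Proof.
  intros hm. unfold btail. apply sum_eq_R0. intros k _.
  destruct (le_dec m k); [|reflexivity]. unfold bterm. rewrite pow_i by lia. ring.
Qed.

Lemma btail_1 (n m : nat) : (m <= n)%nat -> btail n m n 1 = 1.
Proof.
  intros hm. unfold btail.
  assert (hz : forall N, (N < n)%nat ->
    sum_f_R0 (fun k => if le_dec m k then bterm n k 1 else 0) N = 0).
  { intros N hN. apply sum_eq_R0. intros k hk. destruct (le_dec m k); [|reflexivity].
    unfold bterm. rewrite Rminus_diag, (pow_i (n - k)) by lia. ring. }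
  assert (hl : (if le_dec m n then bterm n n 1 else 0) = 1).
  { destruct (le_dec m n); [|lia]. unfold bterm, Binomial.C.
    rewrite pow1, Nat.sub_diag. simpl. field. apply INR_fact_neq_0. }
  destruct n as [|n']; [exact hl|].
  rewrite tech5, hz, hl by lia. ring.
Qed.

Lemma PX_btail (n m : nat) (theta phi : R) : INR n * theta = INR m ->
  PX n theta phi = btail n m n phi.
Proof.
  intros e. unfold PX, btail. apply sum_eq. intros k _. rewrite e.
  destruct (Rle_dec (INR m) (INR k)) as [h|h]; destruct (le_dec m k) as [h'|h']; try reflexivity.
  - now apply INR_le in h.
  - now apply le_INR in h'.
Qed.

(** * Comparison of the binomial and normal tails *)

Definition rscale (n : nat) (th : R) : R := sqrt (INR n * th * (1 - th)).

(** Point mass at the mean divided by the peak 1 / (sqrt (2 pi) r) of the normal density with the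
    same variance. *)
Definition kappa (n m : nat) (th : R) : R := sqrt (2 * PI) * rscale n th * bterm n m th.

Lemma mean_interior (n m : nat) (th : R) : (1 <= n)%nat -> 0 < th < 1 -> INR n * th = INR m ->
  (1 <= m < n)%nat.
Proof.
  intros hn ht e. assert (0 < INR n) by (apply lt_0_INR; lia). split.
  - apply INR_lt. simpl. rewrite <- e. nra.
  - apply INR_lt. rewrite <- e. nra.
Qed.

Lemma rscale_pos (n : nat) (th : R) : (1 <= n)%nat -> 0 < th < 1 -> 0 < rscale n th.
Proof.
  intros hn ht. assert (0 < INR n) by (apply lt_0_INR; lia). apply sqrt_lt_R0.
  assert (0 < th * (1 - th)) by nra. nra.
Qed.

Lemma rscale_sqr (n : nat) (th : R) : 0 < th < 1 -> rscale n th ^ 2 = INR n * th * (1 - th).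
Proof.
  intros ht. unfold rscale. rewrite <- Rsqr_pow2. apply Rsqr_sqrt.
  pose proof (pos_INR n). assert (0 < th * (1 - th)) by nra. nra.
Qed.

Lemma binomial_pos (n k : nat) : 0 < Binomial.C n k.
Proof.
  unfold Binomial.C. apply Rdiv_lt_0_compat; [|apply Rmult_lt_0_compat]; apply INR_fact_lt_0.
Qed.

Lemma bterm_pos (n k : nat) (phi : R) : 0 < phi < 1 -> 0 < bterm n k phi.
Proof.
  intros h. unfold bterm.
  apply Rmult_lt_0_compat; [apply Rmult_lt_0_compat|]; [apply binomial_pos | apply pow_lt; lra..].
Qed.

Lemma kappa_pos (n m : nat) (th : R) : (1 <= n)%nat -> 0 < th < 1 -> 0 < kappa n m th.
Proof.
  intros hn ht. unfold kappa.
  apply Rmult_lt_0_compat; [apply Rmult_lt_0_compat|];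
    [apply sqrt_2PI_pos | now apply rscale_pos | now apply bterm_pos].
Qed.

Lemma bterm_exp (n m : nat) (phi : R) : (m <= n)%nat -> 0 < phi < 1 ->
  bterm n m phi = Binomial.C n m * exp (INR m * ln phi + (INR n - INR m) * ln (1 - phi)).
Proof.
  intros hm h. unfold bterm.
  rewrite <- (Rpower_pow m phi), <- (Rpower_pow (n - m) (1 - phi)) by lra.
  rewrite minus_INR by exact hm. rewrite exp_plus. unfold Rpower. ring.
Qed.

(* gauss (sqrt (2 n H)) = e^(- n H) is the likelihood ratio. *)
Lemma bterm_gauss (n m : nat) (th phi : R) : (1 <= n)%nat -> 0 < th < 1 -> 0 < phi < 1 ->
  INR n * th = INR m ->
  bterm n m th * gauss (rscale n th * dev th phi) = bterm n m phi.
Proof.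
  intros hn ht hp e. pose proof (mean_interior n m th hn ht e).
  rewrite !bterm_exp by (lia || lra). unfold gauss. rewrite Rmult_assoc, <- exp_plus.
  do 2 f_equal. rewrite Rpow_mult_distr, rscale_sqr by exact ht.
  replace (INR n * th * (1 - th) * dev th phi ^ 2)
    with (INR n * (th * (1 - th) * dev th phi ^ 2)) by ring.
  rewrite dev_sqr by assumption. unfold kl. rewrite <- e. field.
Qed.

Lemma is_derive_dev (th phi : R) : 0 < th < 1 -> 0 < phi < 1 -> phi <> th ->
  is_derive (dev th) phi ((phi - th) / (phi * (1 - phi) * (th * (1 - th)) * dev th phi)).
Proof.
  intros ht hp hne. pose proof (kl_pos th phi ht hp hne).
  assert (0 < th * (1 - th)) by nra.
  assert (hpos : 0 < 2 * kl th phi / (th * (1 - th))) by (apply Rdiv_lt_0_compat; lra).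
  assert (hd : 0 < dev th phi) by now apply sqrt_lt_R0.
  unfold dev at 1. evar_last.
  - apply (is_derive_comp sqrt (fun p => 2 * kl th p / (th * (1 - th)))).
    + apply is_derive_Reals. now apply derivable_pt_lim_sqrt.
    + apply (is_derive_ext (fun p => 2 / (th * (1 - th)) * kl th p)).
      { intros t. simpl. field. lra. }
      apply (is_derive_scal (kl th)), is_derive_kl. exact hp.
  - unfold scal; simpl; unfold mult; simpl. fold (dev th phi). field. lra.
Qed.

Lemma continuity_pt_dev (th phi : R) : 0 < phi < 1 -> continuity_pt (dev th) phi.
Proof.
  intros hp. apply continuity_pt_filterlim.
  apply (continuous_sqrt_comp (fun p => 2 * kl th p / (th * (1 - th)))).
  apply (ex_derive_continuous (fun p => 2 * kl th p / (th * (1 - th)))).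
  eexists. apply (is_derive_ext (fun p => 2 / (th * (1 - th)) * kl th p)).
  { intros t. simpl. unfold Rdiv. ring. }
  apply (is_derive_scal (kl th)), is_derive_kl. exact hp.
Qed.

(** Since G' = - x G, the correction d G / r multiplies the derivative of Q by 1 + d x / r, that is
    by 1 + d u; d = 0, 1, -1 give the extreme values of g in the overview. *)
Definition approx (d r x : R) : R := Qf x + d / r * gdens x.

Lemma is_derive_approx (d r x : R) : is_derive (approx d r) x (- gdens x * (1 + d * x / r)).
Proof.
  unfold approx. evar_last.
  - apply (is_derive_plus Qf); [apply is_derive_Qf | apply (is_derive_scal gdens), is_derive_gdens].
  - unfold plus; simpl. unfold Rdiv. ring.
Qed.

(** Multiplied by [kappa], the right-hand side is a constant times [bterm n m phi], which vanishes
    at 0 and 1; this controls [gap] near the ends, where [dev] is unbounded. *)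
Lemma approx_bound (d r x : R) : 0 < r -> 0 <= x -> -1 <= d <= 1 ->
  Rabs (approx d r x) <= (/ 2 + / (r * sqrt (2 * PI))) * gauss x.
Proof.
  intros hr hx hd. pose proof (Qf_upper x hx). pose proof (Qf_pos x hx).
  pose proof (gauss_pos x). pose proof sqrt_2PI_pos.
  assert (e : gdens x / r = / (r * sqrt (2 * PI)) * gauss x) by (unfold gdens; field; lra).
  assert (0 < gdens x / r) by (apply Rdiv_lt_0_compat; [apply gdens_pos|exact hr]).
  unfold approx. replace (d / r * gdens x) with (d * (gdens x / r)) by (field; lra).
  rewrite Rmult_plus_distr_r, <- e. apply Rabs_le. split; nra.
Qed.

(* The two one-sided comparisons at once: c = -1 compares btail with kappa * approx
   on the left of th, and c = 1 compares 1 - btail with it on the right. *)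
Definition gap (n m : nat) (th c d phi : R) : R :=
  btail n m n phi + c * kappa n m th * approx d (rscale n th) (rscale n th * dev th phi).

(** By [bterm_gauss] both summands have a derivative proportional to [bterm n m phi], so only the
    sign of the last bracket matters afterwards. *)
Lemma is_derive_gap (n m : nat) (th c d phi : R) :
  (1 <= n)%nat -> 0 < th < 1 -> 0 < phi < 1 -> phi <> th -> INR n * th = INR m ->
  is_derive (gap n m th c d) phi
    (INR n * bterm n m phi / phi *
     (th + c * (1 + d * dev th phi) * (th - phi) / (dev th phi * (1 - phi)))).
Proof.
  intros hn ht hp hne e.
  pose proof (mean_interior n m th hn ht e) as hm.
  pose proof (rscale_pos n th hn ht) as hr.
  pose proof (rscale_sqr n th ht) as hr2.
  pose proof (dev_pos_strict th phi ht hp hne) as hu.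
  pose proof sqrt_2PI_pos as hs.
  unfold gap. evar_last.
  - apply (is_derive_plus (btail n m n)); [apply is_derive_btail; lia|].
    apply (is_derive_scal (fun p => approx d (rscale n th) (rscale n th * dev th p))).
    apply (is_derive_comp (approx d (rscale n th)) (fun p => rscale n th * dev th p)).
    + apply is_derive_approx.
    + apply (is_derive_scal (dev th)), is_derive_dev; assumption.
  - unfold plus, scal; simpl; unfold mult; simpl.
    assert (e1 : INR m * Binomial.C n m * phi ^ (m - 1) * (1 - phi) ^ (n - m)
                 = INR n * th * bterm n m phi / phi).
    (* The fifth occurrence of [m] is the exponent of phi on the right; splitting it off cancels the
       division by phi. *)
    { unfold bterm. rewrite <- e. replace m with (S (m - 1)) at 5 by lia. simpl. field. lra. }
    rewrite e1. unfold kappa, gdens.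
    rewrite <- (bterm_gauss n m th phi hn ht hp e).
    set (g := gauss _). set (u := dev th phi) in *. set (r := rscale n th) in *.
    set (b := bterm n m th). set (s := sqrt (2 * PI)) in *.
    (* Isolates r^2 / (th (1 - th)), which equals n by [rscale_sqr]. *)
    transitivity (INR n * th * (b * g) / phi
      - c * b * g * (1 + d * u) * (r ^ 2 / (th * (1 - th))) * (phi - th) / (phi * (1 - phi) * u)).
    + field. repeat split; lra.
    + rewrite hr2. field. repeat split; lra.
Qed.

Lemma continuity_pt_gap (n m : nat) (th c d phi : R) : (1 <= m <= n)%nat -> 0 < phi < 1 ->
  continuity_pt (gap n m th c d) phi.
Proof.
  intros hm hp. unfold gap.
  apply (continuity_pt_plus (btail n m n)).
  - apply derivable_continuous_pt. eexists. apply is_derive_Reals. now apply is_derive_btail.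
  - apply (continuity_pt_scal (fun p => approx d (rscale n th) (rscale n th * dev th p))).
    apply (continuity_pt_comp (fun p => rscale n th * dev th p) (approx d (rscale n th))).
    + apply (continuity_pt_scal (dev th)). now apply continuity_pt_dev.
    + apply derivable_continuous_pt. eexists. apply is_derive_Reals, is_derive_approx.
Qed.

Lemma continuity_pt_btail (n m : nat) (phi : R) : (1 <= m <= n)%nat ->
  continuity_pt (btail n m n) phi.
Proof.
  intros hm. apply derivable_continuous_pt. eexists. apply is_derive_Reals. now apply is_derive_btail.
Qed.

Lemma continuity_pt_bterm (n k : nat) (phi : R) : continuity_pt (bterm n k) phi.
Proof. apply derivable_continuous_pt. eexists. apply is_derive_Reals, is_derive_bterm. Qed.

Lemma gap_near (n m : nat) (th c d e phi : R) :
  (1 <= n)%nat -> 0 < th < 1 -> 0 < phi < 1 -> INR n * th = INR m ->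
  -1 <= c <= 1 -> -1 <= d <= 1 ->
  Rabs (gap n m th c d phi - e) <= Rabs (btail n m n phi - e)
    + sqrt (2 * PI) * rscale n th * (/ 2 + / (rscale n th * sqrt (2 * PI))) * bterm n m phi.
Proof.
  intros hn ht hp em hc hd. unfold gap.
  pose proof (rscale_pos n th hn ht) as hr. pose proof sqrt_2PI_pos as hs.
  pose proof (approx_bound d (rscale n th) (rscale n th * dev th phi) hr
    ltac:(apply Rmult_le_pos; [lra|apply dev_pos]) hd) as ha.
  rewrite <- (bterm_gauss n m th phi hn ht hp em).
  pose proof (kappa_pos n m th hn ht) as hk.
  set (a := approx _ _ _) in *. set (g := gauss _) in *.
  replace (btail n m n phi + c * kappa n m th * a - e)
    with (btail n m n phi - e + c * (kappa n m th * a)) by ring.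
  eapply Rle_trans; [apply Rabs_triang|]. apply Rplus_le_compat_l.
  rewrite !Rabs_mult. rewrite (Rabs_pos_eq (kappa n m th)) by lra.
  assert (Rabs c <= 1) by (apply Rabs_le; lra).
  apply Rle_trans with (1 * (kappa n m th * ((/ 2 + / (rscale n th * sqrt (2 * PI))) * g))).
  - apply Rmult_le_compat; [apply Rabs_pos | | lra |].
    + apply Rmult_le_pos; [lra|apply Rabs_pos].
    + apply Rmult_le_compat_l; lra.
  - right. unfold kappa. ring.
Qed.

Lemma small_near (f : R -> R) (a eps : R) : continuity_pt f a -> f a = 0 -> 0 < eps ->
  exists del, 0 < del /\ forall y, Rabs (y - a) < del -> Rabs (f y) < eps.
Proof.
  intros hc h0 he. destruct (hc eps he) as [del [hd h]].
  exists del. split; [exact hd|]. intros y hy.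
  destruct (Req_dec y a) as [->|hne]; [rewrite h0, Rabs_R0; exact he|].
  specialize (h y). simpl in h. unfold R_dist, D_x, no_cond in h.
  rewrite h0, Rminus_0_r in h. apply h. repeat split; auto.
Qed.

(** At 0 both [btail] and [bterm n m] vanish because m >= 1. *)
Lemma gap_limit_0 (n m : nat) (th c d eps : R) :
  (1 <= n)%nat -> 0 < th < 1 -> INR n * th = INR m -> -1 <= c <= 1 -> -1 <= d <= 1 -> 0 < eps ->
  exists del, 0 < del /\ forall y, 0 < y < 1 -> y < del -> Rabs (gap n m th c d y) <= eps.
Proof.
  intros hn ht em hc hd he. pose proof (mean_interior n m th hn ht em) as hm.
  set (K := sqrt (2 * PI) * rscale n th * (/ 2 + / (rscale n th * sqrt (2 * PI)))).
  destruct (small_near (fun y => Rabs (btail n m n y) + K * bterm n m y) 0 eps) as [del [h1 h2]].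
  - apply (continuity_pt_plus (fun y => Rabs (btail n m n y))).
    + apply (continuity_pt_comp (btail n m n) Rabs); [apply continuity_pt_btail; lia | apply Rcontinuity_abs].
    + apply (continuity_pt_scal (bterm n m)), continuity_pt_bterm.
  - rewrite btail_0 by lia. rewrite Rabs_R0. unfold bterm. rewrite pow_i by lia. ring.
  - exact he.
  - exists del. split; [exact h1|]. intros y hy hyd.
    pose proof (gap_near n m th c d 0 y hn ht hy em hc hd) as h.
    rewrite !Rminus_0_r in h. fold K in h.
    specialize (h2 y). rewrite Rminus_0_r, (Rabs_pos_eq y) in h2 by lra.
    specialize (h2 hyd). apply Rabs_def2 in h2. lra.
Qed.

(** At 1 the tail is 1 and [bterm n m] vanishes because m < n. *)
Lemma gap_limit_1 (n m : nat) (th c d eps : R) :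
  (1 <= n)%nat -> 0 < th < 1 -> INR n * th = INR m -> -1 <= c <= 1 -> -1 <= d <= 1 -> 0 < eps ->
  exists del, 0 < del /\ forall y, 0 < y < 1 -> 1 - y < del -> Rabs (gap n m th c d y - 1) <= eps.
Proof.
  intros hn ht em hc hd he. pose proof (mean_interior n m th hn ht em) as hm.
  set (K := sqrt (2 * PI) * rscale n th * (/ 2 + / (rscale n th * sqrt (2 * PI)))).
  destruct (small_near (fun y => Rabs (btail n m n y - 1) + K * bterm n m y) 1 eps) as [del [h1 h2]].
  - apply (continuity_pt_plus (fun y => Rabs (btail n m n y - 1))).
    + apply (continuity_pt_comp (fun y => btail n m n y - 1) Rabs); [|apply Rcontinuity_abs].
      apply (continuity_pt_minus (btail n m n) (fun _ => 1)); [apply continuity_pt_btail; lia|].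
      apply continuity_pt_const. intros ? ?; reflexivity.
    + apply (continuity_pt_scal (bterm n m)), continuity_pt_bterm.
  - rewrite btail_1 by lia. rewrite Rminus_diag, Rabs_R0. unfold bterm.
    rewrite Rminus_diag, (pow_i (n - m)) by lia. ring.
  - exact he.
  - exists del. split; [exact h1|]. intros y hy hyd.
    pose proof (gap_near n m th c d 1 y hn ht hy em hc hd) as h. fold K in h.
    specialize (h2 y). rewrite Rabs_minus_sym, (Rabs_pos_eq (1 - y)) in h2 by lra.
    specialize (h2 hyd). apply Rabs_def2 in h2. lra.
Qed.

(** After clearing denominators, the sign of the derivative is exactly [dev_lower_left]. The next
    three lemmas use [dev_upper_left], [dev_upper_right] and [dev_lower_right] in the same way. *)
Lemma gap_left_incr (n m : nat) (th x y : R) :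
  (1 <= n)%nat -> 0 < th < 1 -> INR n * th = INR m -> 0 < x <= y -> y <= th ->
  gap n m th (-1) 0 x <= gap n m th (-1) 0 y.
Proof.
  intros hn ht em hx hy. pose proof (mean_interior n m th hn ht em) as hm.
  apply (MVT_incr (gap n m th (-1) 0) (fun p => INR n * bterm n m p / p *
     (th + -1 * (1 + 0 * dev th p) * (th - p) / (dev th p * (1 - p))))); [lra| | |].
  - intros p hp. apply is_derive_gap; try assumption; lra.
  - intros p hp. apply continuity_pt_gap; [lia|lra].
  - intros p hp.
    pose proof (dev_pos_strict th p ht ltac:(lra) ltac:(lra)) as hu.
    pose proof (dev_lower_left th p ltac:(lra) ltac:(lra)) as hl.
    pose proof (bterm_pos n m p ltac:(lra)) as hb. pose proof (pos_INR n).
    apply Rmult_le_pos; [apply Rdiv_le_0_compat; [apply Rmult_le_pos|]; lra|].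
    apply Rle_div_l in hl; [|nra].
    assert ((th - p) / (dev th p * (1 - p)) <= th); [|lra].
    apply div_le_of_mul; nra.
Qed.

Lemma gap_left_decr (n m : nat) (th x y : R) :
  (1 <= n)%nat -> 0 < th < 1 -> INR n * th = INR m -> 0 < x <= y -> y <= th ->
  gap n m th (-1) 1 y <= gap n m th (-1) 1 x.
Proof.
  intros hn ht em hx hy. pose proof (mean_interior n m th hn ht em) as hm.
  apply Ropp_le_cancel.
  apply (MVT_incr (fun p => - gap n m th (-1) 1 p) (fun p => - (INR n * bterm n m p / p *
     (th + -1 * (1 + 1 * dev th p) * (th - p) / (dev th p * (1 - p)))))); [lra| | |].
  - intros p hp. apply (is_derive_opp (gap n m th (-1) 1)).
    apply is_derive_gap; try assumption; lra.
  - intros p hp. apply (continuity_pt_opp (gap n m th (-1) 1)), continuity_pt_gap; [lia|lra].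
  - intros p hp.
    pose proof (dev_pos_strict th p ht ltac:(lra) ltac:(lra)) as hu.
    pose proof (dev_upper_left th p ltac:(lra) ltac:(lra)) as hl.
    pose proof (bterm_pos n m p ltac:(lra)) as hb. pose proof (pos_INR n).
    rewrite <- Ropp_mult_distr_r_reverse.
    apply Rmult_le_pos; [apply Rdiv_le_0_compat; [apply Rmult_le_pos|]; lra|].
    apply Rle_div_r in hl; [|nra].
    assert (th <= (1 + 1 * dev th p) * (th - p) / (dev th p * (1 - p))); [|lra].
    apply le_div_of_mul; nra.
Qed.

Lemma gap_right_decr (n m : nat) (th x y : R) :
  (1 <= n)%nat -> 0 < th < 1 -> INR n * th = INR m -> th <= x <= y -> y < 1 ->
  gap n m th 1 0 y <= gap n m th 1 0 x.
Proof.
  intros hn ht em hx hy. pose proof (mean_interior n m th hn ht em) as hm.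
  apply Ropp_le_cancel.
  apply (MVT_incr (fun p => - gap n m th 1 0 p) (fun p => - (INR n * bterm n m p / p *
     (th + 1 * (1 + 0 * dev th p) * (th - p) / (dev th p * (1 - p)))))); [lra| | |].
  - intros p hp. apply (is_derive_opp (gap n m th 1 0)).
    apply is_derive_gap; try assumption; lra.
  - intros p hp. apply (continuity_pt_opp (gap n m th 1 0)), continuity_pt_gap; [lia|lra].
  - intros p hp.
    pose proof (dev_pos_strict th p ht ltac:(lra) ltac:(lra)) as hu.
    pose proof (dev_upper_right th p ltac:(lra) ltac:(lra)) as hl.
    pose proof (bterm_pos n m p ltac:(lra)) as hb. pose proof (pos_INR n).
    rewrite <- Ropp_mult_distr_r_reverse.
    apply Rmult_le_pos; [apply Rdiv_le_0_compat; [apply Rmult_le_pos|]; lra|].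
    apply Rle_div_r in hl; [|nra].
    assert ((th - p) / (dev th p * (1 - p)) <= - th); [|lra].
    apply div_le_of_mul; nra.
Qed.

Lemma gap_right_incr (n m : nat) (th x y : R) :
  (1 <= n)%nat -> 0 < th < 1 -> INR n * th = INR m -> th <= x <= y -> y < 1 ->
  gap n m th 1 (-1) x <= gap n m th 1 (-1) y.
Proof.
  intros hn ht em hx hy. pose proof (mean_interior n m th hn ht em) as hm.
  apply (MVT_incr (gap n m th 1 (-1)) (fun p => INR n * bterm n m p / p *
     (th + 1 * (1 + -1 * dev th p) * (th - p) / (dev th p * (1 - p))))); [lra| | |].
  - intros p hp. apply is_derive_gap; try assumption; lra.
  - intros p hp. apply continuity_pt_gap; [lia|lra].
  - intros p hp.
    pose proof (dev_pos_strict th p ht ltac:(lra) ltac:(lra)) as hu.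
    pose proof (dev_lower_right th p ltac:(lra) ltac:(lra)) as hl.
    pose proof (bterm_pos n m p ltac:(lra)) as hb. pose proof (pos_INR n).
    apply Rmult_le_pos; [apply Rdiv_le_0_compat; [apply Rmult_le_pos|]; lra|].
    apply Rle_div_l in hl; [|nra].
    assert (- th <= (1 + -1 * dev th p) * (th - p) / (dev th p * (1 - p))); [|lra].
    apply le_div_of_mul; nra.
Qed.

(** Monotonicity is combined with the limit 0 at the left end; the two lemmas on the right of [th]
    use the limit 1 at the other end. *)
Lemma gap_left_pos (n m : nat) (th phi : R) :
  (1 <= n)%nat -> 0 < th < 1 -> INR n * th = INR m -> 0 < phi <= th ->
  0 <= gap n m th (-1) 0 phi.
Proof.
  intros hn ht em hp. apply le_epsilon. intros eps he.
  destruct (gap_limit_0 n m th (-1) 0 eps hn ht em ltac:(lra) ltac:(lra) he) as [del [h1 h2]].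
  set (y := Rmin phi (del / 2)).
  assert (0 < y <= phi /\ y < del) as [hy1 hy2].
  { unfold y. destruct (Rle_dec phi (del / 2)); [rewrite Rmin_left|rewrite Rmin_right]; lra. }
  specialize (h2 y ltac:(lra) hy2). apply Rabs_le_between in h2.
  pose proof (gap_left_incr n m th y phi hn ht em hy1 ltac:(lra)). lra.
Qed.

Lemma gap_left_neg (n m : nat) (th phi : R) :
  (1 <= n)%nat -> 0 < th < 1 -> INR n * th = INR m -> 0 < phi <= th ->
  gap n m th (-1) 1 phi <= 0.
Proof.
  intros hn ht em hp. apply le_epsilon. intros eps he.
  destruct (gap_limit_0 n m th (-1) 1 eps hn ht em ltac:(lra) ltac:(lra) he) as [del [h1 h2]].
  set (y := Rmin phi (del / 2)).
  assert (0 < y <= phi /\ y < del) as [hy1 hy2].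
  { unfold y. destruct (Rle_dec phi (del / 2)); [rewrite Rmin_left|rewrite Rmin_right]; lra. }
  specialize (h2 y ltac:(lra) hy2). apply Rabs_le_between in h2.
  pose proof (gap_left_decr n m th y phi hn ht em hy1 ltac:(lra)). lra.
Qed.

Lemma gap_right_ge_1 (n m : nat) (th phi : R) :
  (1 <= n)%nat -> 0 < th < 1 -> INR n * th = INR m -> th <= phi < 1 ->
  1 <= gap n m th 1 0 phi.
Proof.
  intros hn ht em hp. apply le_epsilon. intros eps he.
  destruct (gap_limit_1 n m th 1 0 eps hn ht em ltac:(lra) ltac:(lra) he) as [del [h1 h2]].
  set (y := Rmax phi (1 - del / 2)).
  assert (phi <= y < 1 /\ 1 - y < del) as [hy1 hy2].
  { unfold y. destruct (Rle_dec phi (1 - del / 2)); [rewrite Rmax_right|rewrite Rmax_left]; lra. }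
  specialize (h2 y ltac:(lra) hy2). apply Rabs_le_between in h2.
  pose proof (gap_right_decr n m th phi y hn ht em ltac:(lra) ltac:(lra)). lra.
Qed.

Lemma gap_right_le_1 (n m : nat) (th phi : R) :
  (1 <= n)%nat -> 0 < th < 1 -> INR n * th = INR m -> th <= phi < 1 ->
  gap n m th 1 (-1) phi <= 1.
Proof.
  intros hn ht em hp. apply le_epsilon. intros eps he.
  destruct (gap_limit_1 n m th 1 (-1) eps hn ht em ltac:(lra) ltac:(lra) he) as [del [h1 h2]].
  set (y := Rmax phi (1 - del / 2)).
  assert (phi <= y < 1 /\ 1 - y < del) as [hy1 hy2].
  { unfold y. destruct (Rle_dec phi (1 - del / 2)); [rewrite Rmax_right|rewrite Rmax_left]; lra. }
  specialize (h2 y ltac:(lra) hy2). apply Rabs_le_between in h2.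
  pose proof (gap_right_incr n m th phi y hn ht em ltac:(lra) ltac:(lra)). lra.
Qed.

Lemma btail_lower (n m : nat) (th phi : R) :
  (1 <= n)%nat -> 0 < th < 1 -> INR n * th = INR m -> 0 < phi <= th ->
  kappa n m th * Qf (rscale n th * dev th phi) <= btail n m n phi.
Proof.
  intros hn ht em hp. pose proof (gap_left_pos n m th phi hn ht em hp) as h.
  unfold gap, approx, Rdiv in h. rewrite !Rmult_0_l, Rplus_0_r in h. lra.
Qed.

Lemma btail_upper (n m : nat) (th phi : R) :
  (1 <= n)%nat -> 0 < th < 1 -> INR n * th = INR m -> 0 < phi <= th ->
  btail n m n phi <= kappa n m th *
    (Qf (rscale n th * dev th phi) + gdens (rscale n th * dev th phi) / rscale n th).
Proof.
  intros hn ht em hp. pose proof (gap_left_neg n m th phi hn ht em hp) as h.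
  unfold gap, approx in h.
  replace (1 / rscale n th * gdens (rscale n th * dev th phi))
    with (gdens (rscale n th * dev th phi) / rscale n th) in h by (unfold Rdiv; ring). lra.
Qed.

Lemma approx_0 (d r : R) : r <> 0 -> approx d r 0 = / 2 + d * / (r * sqrt (2 * PI)).
Proof.
  intros hr. unfold approx. rewrite Qf_0, gdens_0. pose proof sqrt_2PI_pos. field. lra.
Qed.

(** The left bound P >= kappa / 2 and the right bound 1 - P <= kappa / 2 together eliminate
    [kappa]. *)
Lemma btail_mean_ge_half (n m : nat) (th : R) :
  (1 <= n)%nat -> 0 < th < 1 -> INR n * th = INR m -> / 2 <= btail n m n th.
Proof.
  intros hn ht em. pose proof (rscale_pos n th hn ht).
  pose proof (gap_left_pos n m th th hn ht em ltac:(lra)) as h1.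
  pose proof (gap_right_ge_1 n m th th hn ht em ltac:(lra)) as h2.
  unfold gap in *. rewrite dev_diag, Rmult_0_r, approx_0 in * by lra. lra.
Qed.

(** At [phi = th] the four comparisons bound P and 1 - P from both sides by multiples of [kappa];
    pairing them so that P cancels leaves [kappa] alone. *)
Lemma kappa_bounds (n m : nat) (th : R) :
  (1 <= n)%nat -> 0 < th < 1 -> INR n * th = INR m ->
  kappa n m th * (1 - / (rscale n th * sqrt (2 * PI))) <= 1
  <= kappa n m th * (1 + / (rscale n th * sqrt (2 * PI))).
Proof.
  intros hn ht em. pose proof (rscale_pos n th hn ht).
  pose proof (gap_left_pos n m th th hn ht em ltac:(lra)) as h1.
  pose proof (gap_left_neg n m th th hn ht em ltac:(lra)) as h2.
  pose proof (gap_right_ge_1 n m th th hn ht em ltac:(lra)) as h3.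
  pose proof (gap_right_le_1 n m th th hn ht em ltac:(lra)) as h4.
  unfold gap in *. rewrite dev_diag, Rmult_0_r, approx_0 in * by lra. lra.
Qed.

(** * Bounds on gamma *)

Lemma sqrt_between (a b x : R) : 0 <= a -> 0 <= b -> a ^ 2 <= x <= b ^ 2 -> a <= sqrt x <= b.
Proof.
  intros ha hb h. rewrite <- (sqrt_pow2 a ha), <- (sqrt_pow2 b hb).
  split; apply sqrt_le_1_alt; lra.
Qed.

Lemma sqrt_2PI_lower : 12 / 5 <= sqrt (2 * PI).
Proof.
  pose proof PI2_3_2. pose proof PI_RGT_0.
  rewrite <- (sqrt_pow2 (12 / 5)) by lra. apply sqrt_le_1_alt. lra.
Qed.

Lemma exp_opp_le_inv (y : R) : 0 <= y -> exp (- y) * (1 + y) <= 1.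
Proof.
  intros hy. pose proof (exp_ge_1 y). pose proof (exp_pos (- y)).
  replace 1 with (exp (- y) * exp y) at 2 by (rewrite <- exp_plus, Rplus_opp_l; apply exp_0).
  apply Rmult_le_compat_l; lra.
Qed.

Lemma exp_le_mono (x y : R) : x <= y -> exp x <= exp y.
Proof. intros [h|h]; [left; now apply exp_increasing | rewrite h; apply Rle_refl]. Qed.

(** Intermediate values: the tail is 0 at 0 and at least 1/2 > e^(-alpha) at [th]. *)
Lemma btail_level (n m : nat) (th alpha : R) :
  (1 <= n)%nat -> 0 < th < 1 -> INR n * th = INR m -> ln 2 < alpha ->
  exists phi, 0 < phi <= th /\ btail n m n phi = exp (- alpha).
Proof.
  intros hn ht em ha. pose proof (mean_interior n m th hn ht em) as hm.
  pose proof (btail_mean_ge_half n m th hn ht em) as hh.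
  assert (hx : exp (- alpha) < / 2).
  { rewrite <- (exp_ln (/ 2)) by lra. apply exp_increasing. rewrite ln_Rinv by lra. lra. }
  pose proof (exp_pos (- alpha)) as hp.
  destruct (IVT_gen (btail n m n) 0 th (exp (- alpha))) as [phi [hphi e]].
  - intros x. apply continuity_pt_btail. lia.
  - rewrite btail_0 by lia. rewrite Rmin_left, Rmax_right by lra. lra.
  - rewrite Rmin_left, Rmax_right in hphi by lra. exists phi. split; [|exact e].
    destruct (Req_dec phi 0) as [e0|e0]; [|lra].
    rewrite e0, btail_0 in e by lia. lra.
Qed.

Lemma inv_r_bound (r : R) : 0 < r -> 0 < / (r * sqrt (2 * PI)) <= 5 / 12 / r.
Proof.
  intros hr. pose proof sqrt_2PI_lower. pose proof sqrt_2PI_pos. split.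
  - apply Rinv_0_lt_compat. nra.
  - replace (5 / 12 / r) with (/ (r * (12 / 5))) by (field; lra).
    apply Rinv_le_contravar; nra.
Qed.

(** With t = 1 / (r sqrt (2 pi)), the upper comparison gives P <= kappa (1/2 + t) [gauss x]. For r
    >= 4, t < 1/4, so this factor is at most kappa (1 - t) <= 1. *)
Lemma btail_chernoff (n m : nat) (th phi : R) :
  (1 <= n)%nat -> 0 < th < 1 -> INR n * th = INR m -> 0 < phi <= th -> 4 <= rscale n th ->
  btail n m n phi <= gauss (rscale n th * dev th phi).
Proof.
  intros hn ht em hp hr.
  pose proof (btail_upper n m th phi hn ht em hp) as h.
  pose proof (kappa_bounds n m th hn ht em) as [hk _].
  pose proof (kappa_pos n m th hn ht) as hk0.
  pose proof (inv_r_bound (rscale n th) ltac:(lra)) as hi.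
  assert (5 / 12 / rscale n th <= 5 / 12 / 4).
  { apply Rmult_le_compat_l; [lra|]. apply Rinv_le_contravar; lra. }
  pose proof sqrt_2PI_pos as hs.
  assert (hx : 0 <= rscale n th * dev th phi) by (apply Rmult_le_pos; [lra|apply dev_pos]).
  pose proof (Qf_upper _ hx) as hq. pose proof (gauss_pos (rscale n th * dev th phi)) as hg.
  set (x := rscale n th * dev th phi) in *. set (r := rscale n th) in *.
  assert (e : gdens x / r = / (r * sqrt (2 * PI)) * gauss x) by (unfold gdens; field; lra).
  rewrite e in h. set (t := / (r * sqrt (2 * PI))) in *. set (k := kappa n m th) in *.
  eapply Rle_trans; [exact h|].
  apply Rle_trans with (k * (/ 2 + t) * gauss x).
  - rewrite Rmult_assoc. apply Rmult_le_compat_l; lra.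
  - rewrite <- (Rmult_1_l (gauss x)) at 2. apply Rmult_le_compat_r; [lra|].
    apply Rle_trans with (k * (1 - t)); [apply Rmult_le_compat_l; lra|exact hk].
Qed.

(** Rational estimates replacing the radicals and pi, so that the final inequalities are polynomial
    in s and 1 / r. *)
Lemma constants_bounds (alpha : R) : / 2 <= alpha ->
  let s := sqrt alpha in
  s * s = alpha /\ 7 / 10 <= s
  /\ 11 / 10 * s <= 64 * s / (15 * sqrt 15)
  /\ 7 / 10 + 206 / 100 * s <= sqrt (PI / 6) + 8 * s / sqrt 15
  /\ 71 / 100 * s <= 2 * s / sqrt 5 <= s.
Proof.
  intros ha s.
  assert (hs : 7 / 10 <= s).
  { rewrite <- (sqrt_pow2 (7 / 10)) by lra. apply sqrt_le_1_alt. lra. }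
  assert (h15 : 387 / 100 <= sqrt 15 <= 3873 / 1000) by (apply sqrt_between; lra).
  assert (h5 : 2 <= sqrt 5 <= 224 / 100) by (apply sqrt_between; lra).
  assert (hpi : 7 / 10 <= sqrt (PI / 6)).
  { pose proof PI2_3_2. rewrite <- (sqrt_pow2 (7 / 10)) by lra. apply sqrt_le_1_alt. lra. }
  split; [apply sqrt_sqrt; lra|]. split; [exact hs|].
  split; [apply le_div_of_mul; nra|].
  split; [|split; [apply le_div_of_mul; nra | apply div_le_of_mul; nra]].
  assert (206 / 100 * s <= 8 * s / sqrt 15) by (apply le_div_of_mul; nra). lra.
Qed.

Theorem mainTheorem13 (n : nat) (theta alpha : R) :
  (1 <= n)%nat ->
  0 < theta < 1 ->
  (exists m : nat, INR n * theta = INR m) ->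
  ln 2 < alpha <= INR n * theta ^ 2 * (1 - theta) ^ 2 / 8 ->
  let r := sqrt (INR n * theta * (1 - theta)) in
  let c1 := 64 * sqrt alpha / (15 * sqrt 15) in
  let c2 := sqrt (PI / 6) + 8 * sqrt alpha / sqrt 15 in
  let c3 := 2 * sqrt alpha / sqrt 5 in
  exists gamma : R,
    - ln (PX n theta (varphi n gamma theta)) = alpha /\
    max0_qinv (alpha * (1 - c1 / r) - c2 / r) * (1 - c3 / r) <= gamma /\
    gamma <= max0_qinv (alpha * (1 + c1 / r) + c2 / r) * (1 + c3 / r).
Proof.
  intros hn ht [m em] [ha1 ha2] r c1 c2 c3.
  pose proof ln_lt_2 as hln.
  destruct (constants_bounds alpha ltac:(lra)) as (hss & hs & hc1 & hc2 & hc3).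
  fold c1 in hc1. fold c2 in hc2. fold c3 in hc3. set (s := sqrt alpha) in *.
  pose proof (rscale_pos n theta hn ht) as hr0. pose proof (rscale_sqr n theta ht) as hr2.
  change (rscale n theta) with r in hr0, hr2.
  (* The upper bound on alpha is r^2 theta (1 - theta) / 8, and theta (1 - theta) <= 1/4. Since
     alpha > 1/2, r >= 4 follows. *)
  assert (hr : 32 * alpha <= r ^ 2).
  { assert (hq : theta * (1 - theta) <= / 4) by (pose proof (pow2_ge_0 (2 * theta - 1)); lra).
    assert (hq0 : 0 < theta * (1 - theta)) by nra.
    replace (INR n * theta ^ 2 * (1 - theta) ^ 2 / 8)
      with (r ^ 2 * (theta * (1 - theta)) / 8) in ha2 by (rewrite hr2; field).
    assert (0 <= r ^ 2) by apply pow2_ge_0. nra. }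
  assert (hr4 : 4 <= r) by nra.
  assert (hsr : s <= r / 5) by nra.
  destruct (btail_level n m theta alpha hn ht em ha1) as [phi [hphi ephi]].
  pose proof (btail_chernoff n m theta phi hn ht em hphi hr4) as hch.
  pose proof (btail_lower n m theta phi hn ht em hphi) as hlo.
  pose proof (btail_upper n m theta phi hn ht em hphi) as hup.
  pose proof (kappa_bounds n m theta hn ht em) as [hk1 hk2].
  pose proof (kappa_pos n m theta hn ht) as hk0.
  pose proof (inv_r_bound r hr0) as hi.
  pose proof (shift_lower theta phi hphi ltac:(lra)) as hwl.
  pose proof (shift_upper theta phi hphi ltac:(lra)) as hwu.
  pose proof (dev_pos theta phi) as hu0.
  change (rscale n theta) with r in *.
  rewrite ephi in hch, hlo, hup.
  set (u := dev theta phi) in *. set (k := kappa n m theta) in *.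
  set (t := / (r * sqrt (2 * PI))) in *. set (x := r * u) in *.
  set (w := (theta - phi) / (theta * (1 - theta))) in *.
  assert (hx0 : 0 <= x) by (apply Rmult_le_pos; lra).
  pose proof (Qf_lower x hx0) as hmills.
  pose proof (Qf_pos x hx0) as hQ.
  pose proof (exp_pos (- alpha)) as hea.
  (* Chernoff at the chosen phi: e^(-alpha) <= e^(-x^2/2). The constant 1.415 below is just above
     sqrt 2. *)
  assert (hxx : x ^ 2 <= 2 * alpha).
  { unfold gauss in hch. apply Rnot_lt_le. intros hlt.
    assert (exp (- x ^ 2 / 2) < exp (- alpha)) by (apply exp_increasing; lra). lra. }
  assert (hxs : x <= 1415 / 1000 * s) by (apply Rnot_lt_le; intros hlt; nra).
  assert (hc3r : c3 / r <= 1) by (apply div_le_of_mul; lra).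
  (* u / 2 = x / (2 r), and x / 2 <= 0.7075 s <= 0.71 s <= c3. *)
  assert (huc : u / 2 <= c3 / r).
  { apply le_div_of_mul; [exact hr0|]. unfold x in hxs. lra. }
  assert (h5r : 5 / 12 / r * r = 5 / 12) by (field; lra).
  (* As r times the standard deviation of the estimate is theta (1 - theta), this gamma gives back
     phi. *)
  exists (r * w). split; [|split].
  - assert (ev : varphi n (r * w) theta = phi).
    { unfold varphi. assert (hn0 : 0 < INR n) by (apply lt_0_INR; lia).
      assert (hq0 : 0 < theta * (1 - theta)) by nra.
      assert (es : sqrt (theta * (1 - theta) / INR n) * r = theta * (1 - theta)).
      { unfold r. rewrite <- sqrt_mult_alt by (apply Rdiv_le_0_compat; lra).
        transitivity (sqrt ((theta * (1 - theta)) ^ 2)); [f_equal; field; lra | apply sqrt_pow2; lra]. }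
      rewrite <- Rmult_assoc, es. unfold w. field. lra. }
    rewrite ev, (PX_btail n m) by exact em. rewrite ephi, ln_exp. ring.
  - apply Rle_trans with (x * (1 - c3 / r)).
    + apply Rmult_le_compat_r; [lra|]. apply max0_qinv_le; [exact hx0|].
      (* From kappa Q(x) <= e^(-alpha) and 1 <= kappa (1 + t). The factor 1 + t <= e^t is then
         absorbed by the shift (alpha c1 + c2) / r. *)
      assert (h1 : Qf x <= exp (- alpha) * (1 + t)).
      { apply (Rmult_le_reg_l k); [exact hk0|]. nra. }
      eapply Rle_trans; [exact h1|].
      apply Rle_trans with (exp (- alpha) * exp t).
      { apply Rmult_le_compat_l; [lra|]. apply exp_ge_1. }
      rewrite <- exp_plus. apply exp_le_mono.
      assert (t <= alpha * (c1 / r) + c2 / r); [|lra].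
      replace (alpha * (c1 / r) + c2 / r) with ((alpha * c1 + c2) / r) by (field; lra).
      apply le_div_of_mul; [exact hr0|]. nra.
    + apply Rle_trans with (x * (1 - u / 2)); [apply Rmult_le_compat_l; lra|].
      unfold x. rewrite Rmult_assoc. apply Rmult_le_compat_l; lra.
  - apply Rle_trans with (x * (1 + c3 / r)).
    + apply Rle_trans with (x * (1 + u / 2)); [|apply Rmult_le_compat_l; lra].
      unfold x. rewrite Rmult_assoc. apply Rmult_le_compat_l; lra.
    + apply Rmult_le_compat_r; [lra|].
      assert (hpos : 0 < (alpha * c1 + c2) / r) by (apply Rdiv_lt_0_compat; nra).
      replace (alpha * (1 + c1 / r) + c2 / r) with (alpha + (alpha * c1 + c2) / r) by (field; lra).
      apply max0_qinv_ge; [lra|].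
      (* The upper shift pays for two losses: z = (x + 1) / r for the density term G / r, by the
         Mills bound, and the remainder y for the deviation of kappa from 1, through e^(-y) <= 1 -
         t. *)
      set (y := (alpha * c1 + c2) / r - (x + 1) / r).
      assert (hy : 51 / 100 / r <= y).
      { unfold y. replace ((alpha * c1 + c2) / r - (x + 1) / r)
          with ((alpha * c1 + c2 - (x + 1)) / r) by (field; lra).
        apply Rmult_le_compat_r; [left; now apply Rinv_0_lt_compat|].
        assert (alpha * c1 >= 11 / 10 * (s * s * s)) by nra.
        assert (s * s * s >= 343 / 1000) by nra. lra. }
      assert (hr_inv : 0 < / r <= / 4).
      { split; [now apply Rinv_0_lt_compat | apply Rinv_le_contravar; lra]. }
      assert (hy0 : 0 <= y) by (unfold Rdiv in hy; lra).
      pose proof (exp_opp_le_inv y hy0) as hey.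
      (* Uses y >= 0.51 / r, t <= (5/12) / r and r >= 4. *)
      assert (hty : 1 <= (1 + y) * (1 - t)) by (unfold Rdiv in *; nra).
      assert (h1 : exp (- y) <= 1 - t).
      { apply (Rmult_le_reg_r (1 + y)); [lra|]. lra. }
      replace (- (alpha + (alpha * c1 + c2) / r)) with (- alpha + - y + - ((x + 1) / r))
        by (unfold y; ring).
      rewrite !exp_plus.
      assert (hz0 : 0 <= (x + 1) / r) by (apply Rdiv_le_0_compat; lra).
      set (z := (x + 1) / r) in *.
      pose proof (exp_opp_le_inv z hz0) as hez.
      assert (hup' : exp (- alpha) <= k * Qf x * (1 + z)).
      { eapply Rle_trans; [exact hup|]. rewrite Rmult_assoc. apply Rmult_le_compat_l; [lra|].
        assert (gdens x / r <= Qf x * z); [|lra].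
        unfold z. apply div_le_of_mul; [exact hr0|].
        replace (Qf x * ((x + 1) / r) * r) with ((x + 1) * Qf x) by (field; lra). exact hmills. }
      pose proof (exp_pos (- y)) as hey0. pose proof (exp_pos (- z)) as hez0.
      (* The surplus factors pair off as kappa (1 - t) <= 1 and e^(-z) (1 + z) <= 1. *)
      apply Rle_trans with (k * Qf x * (1 + z) * (1 - t) * exp (- z)).
      * apply Rmult_le_compat_r; [lra|]. apply Rmult_le_compat; lra.
      * replace (k * Qf x * (1 + z) * (1 - t) * exp (- z))
          with (Qf x * ((k * (1 - t)) * (exp (- z) * (1 + z)))) by ring.
        rewrite <- (Rmult_1_r (Qf x)) at 2. apply Rmult_le_compat_l; [lra|].
        rewrite <- (Rmult_1_r 1). apply Rmult_le_compat; [|nra|lra|lra].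
        apply Rmult_le_pos; lra.
Qed.
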